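(* Let $G(x)$ be an abelian type-definable group and let $\mu\in\mathfrak M_G(\mathcal U)$ be fim and idempotent. Then $\mu$ is generically transitive, i.e. $\mu^{(2)}=f_*(\mu^{(2)})$ where $f(x_1,x_0)=(x_1\cdot x_0,x_0)$ (equivalently, every type in the support of $\mu$ implies $\operatorname{Stab}(\mu)$).
   Context: $T$ complete theory, $\mathcal U$ monster model. $G=G(x)$ a partial type over $\emptyset$ with $G(\mathcal U)$ a group whose operations are restrictions of $\emptyset$-definable functions. Global Keisler measures $\mathfrak M_x(\mathcal U)$; support $S(\mu)$; $\mathfrak M_G(\mathcal U)$: measures whose support types imply $G(x)$. Pushforward $f_*(\mu)(\varphi(y))=\mu(\varphi(f(x)))$; $\operatorname{Stab}(\mu)=\{g\in G(\mathcal U):(x\mapsto x\cdot g)_*\mu=\mu\}$. Invariant, Borel-definable measures, Morley product $(\mu\otimes\nu)(\varphi(x,y))=\int F^\varphi_{\mu,A}\,d\nu$ with $F^\varphi_{\mu,A}(q)=\mu(\varphi(x,b))$, $b\models q\in S_y(A)$; $\mu^{(2)}(x_1,x_0)=\mu(x_1)\otimes\mu(x_0)$, $\mu^{(n+1)}=\mu(x_{n+1})\otimes\mu^{(n)}$. Convolution $(\mu*\nu)(\varphi(x))=(\mu\otimes\nu)(\varphi(x\cdot y))$; idempotent: $\mu*\mu=\mu$. Fim over a small model $M$: $\mu$ Borel-definable, $M$-invariant, and for each $\mathcal L$-formula $\varphi(x,y)$ there are $\theta_n\in\mathcal L(M)$ with $\lim_n\mu^{(n)}(\theta_n)=1$ and,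 for each $\varepsilon>0$, some $n_\varepsilon$ such that $k\ge n_\varepsilon$ and $\models\theta_k(\bar a)$ imply $\sup_b|\operatorname{Av}(\bar a)(\varphi(x,b))-\mu(\varphi(x,b))|<\varepsilon$; fim means fim over some small model. *)

(* Defs.v *)
From HB Require Import structures.
From mathcomp Require Import all_boot all_order all_algebra.
From mathcomp Require Import all_classical all_reals all_analysis.

Set Implicit Arguments.
Unset Strict Implicit.
Unset Printing Implicit Defensive.

Import Order.TTheory GRing.Theory Num.Theory.
Import numFieldNormedType.Exports.

Local Open Scope classical_set_scope.
Local Open Scope card_scope.
Local Open Scope ring_scope.

Record language := Language {
  func : Type;
  func_ar : func -> nat;
  rel_sym : Type;
  rel_ar : rel_sym -> nat }.

Inductive term (L : language) (V : Type) : Type :=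
| Var of V
| App (f : func L) of ('I_(func_ar f) -> term L V).

(* [form L V]: first-order formulas with free variables in [V]; the variable
   bound by [Ex] is [None]. *)
Inductive form (L : language) (V : Type) : Type :=
| Eq of term L V & term L V
| Rel (r : rel_sym L) of ('I_(rel_ar r) -> term L V)
| Not of form L V
| And of form L V & form L V
| Ex of form L (option V).

(* Structures are nonempty; the distinguished point of [dom] plays no role
   other than witnessing this. *)
Record structure (L : language) := Structure {
  dom :> pointedType;
  fint : forall f : func L, ('I_(func_ar f) -> dom) -> dom;
  rint : forall r : rel_sym L, ('I_(rel_ar r) -> dom) -> Prop }.

Fixpoint teval (L : language) (M : structure L) (V : Type)
    (t : term L V) (v : V -> M) : M :=
  match t with
  | Var x => v x
  | App f ts => @fint L M f (fun i => teval (ts i) v)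
  end.

Fixpoint sat (L : language) (M : structure L) (V : Type)
    (phi : form L V) (v : V -> M) : Prop :=
  match phi with
  | Eq s t => teval s v = teval t v
  | Rel r ts => @rint L M r (fun i => teval (ts i) v)
  | Not psi => ~ sat psi v
  | And psi chi => sat psi v /\ sat chi v
  | Ex psi => exists a : M, sat psi (oapp v a)
  end.

Definition theory (L : language) := set (form L void).

Definition models (L : language) (M : structure L) (T : theory L) :=
  forall s, T s -> sat s (@of_void M).

Definition entails (L : language) (T : theory L) (s : form L void) :=
  forall M : structure L, models M T -> sat s (@of_void M).

Definition complete_theory (L : language) (T : theory L) :=
  (exists M : structure L, models M T) /\
  forall s, entails T s \/ entails T (Not s).

Definition elementary_substructure (L : language) (U : structure L)
    (M : set U) :=
  exists (N : structure L) (h : N -> U), range h = M /\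
    forall (V : finType) (phi : form L V) (v : V -> N),
      sat phi v <-> sat phi (h \o v).

Definition automorphism (L : language) (U : structure L) (s : U -> U) :=
  [/\ bijective s,
      forall (f : func L) a, s (@fint L U f a) = @fint L U f (s \o a) &
      forall (r : rel_sym L) a, @rint L U r a <-> @rint L U r (s \o a)].

Definition elementary_map (L : language) (U : structure L) (A : set U)
    (s : U -> U) :=
  forall (V : finType) (phi : form L V) (v : V -> U),
    (forall i, A (v i)) -> (sat phi v <-> sat phi (s \o v)).

(* [vec U I] is U^x for a tuple of variables x indexed by [I]; the
   concatenation (x,y) of tuples indexed by [I] and [J] is indexed by [I + J]. *)
Definition vec (L : language) (U : structure L) (I : Type) : Type := I -> U.

Section Tuples.
Context {L : language} {U : structure L} {I J : Type}.

Definition pairv (x : vec U I) (y : vec U J) : vec U (I + J) :=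
  fun k => match k with inl i => x i | inr j => y j end.
Definition fstv (z : vec U (I + J)) : vec U I := z \o inl.
Definition sndv (z : vec U (I + J)) : vec U J := z \o inr.

(* phi(x,b), for phi(x,y) given as a subset of U^{xy} *)
Definition fiber (D : set (vec U (I + J))) (b : vec U J) : set (vec U I) :=
  [set x | D (pairv x b)].
End Tuples.

(* Formulas over [A] in the variables [I], modulo equivalence in [U], are
   identified with the subsets of U^I that they define; so a partial type over
   [A] is a set of [A]-definable sets. *)
Definition definable (L : language) (U : structure L) (A : set U) (I : Type)
    (D : set (vec U I)) :=
  exists (J : finType) (phi : form L (I + J)) (c : vec U J),
    (forall j, A (c j)) /\ D = [set x | sat phi (pairv x c)].

Definition definable_fun (L : language) (U : structure L) (A : set U)
    (I J : Type) (f : vec U I -> vec U J) :=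
  definable A [set z : vec U (I + J) | sndv z = f (fstv z)].

Definition same_type (L : language) (U : structure L) (A : set U) (J : Type)
    (b b' : vec U J) :=
  forall D, definable A D -> (D b <-> D b').

Definition finitely_satisfiable (T : Type) (p : set (set T)) :=
  forall F : set (set T), finite_set F -> F `<=` p ->
    \bigcap_(D in F) D !=set0.

Definition card_lt (S T : Type) (A : set S) (B : set T) := ~ (B #<= A).

(* [kappa] is a type standing for its cardinality. *)
Definition small (kappa : Type) (T : Type) (A : set T) :=
  card_lt A [set: kappa].

Definition strong_limit (kappa : Type) :=
  forall A : set kappa, small kappa A -> small kappa [set B | B `<=` A].

Definition saturated (kappa : Type) (L : language) (U : structure L) :=
  forall (A : set U) (I : finType) (p : set (set (vec U I))),
    small kappa A -> p `<=` definable A (I := I) -> finitely_satisfiable p ->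
    \bigcap_(D in p) D !=set0.

Definition strongly_homogeneous (kappa : Type) (L : language)
    (U : structure L) :=
  forall (A : set U) (s : U -> U), small kappa A -> elementary_map A s ->
    exists2 t : U -> U, automorphism t & forall x, A x -> t x = s x.

Definition monster_model (kappa : Type) (L : language) (T : theory L)
    (U : structure L) :=
  [/\ models U T, small kappa [set: form L nat], strong_limit kappa,
      saturated kappa U & strongly_homogeneous kappa U].

Definition is_complete_type (L : language) (U : structure L) (A : set U)
    (I : Type) (p : set (set (vec U I))) :=
  [/\ p `<=` definable A (I := I), finitely_satisfiable p &
      forall D, definable A D -> p D \/ p (~` D)].

(* [types A I] is S_x(A) *)
Record types (L : language) (U : structure L) (A : set U) (I : Type) := Types {
  type_set :> set (vec U I) -> Prop;
  typeP : is_complete_type A type_set }.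
Arguments types {L U} A I.

Lemma definableC (L : language) (U : structure L) (A : set U) (I : Type)
  (D : set (vec U I)) : definable A D -> definable A (~` D).
Proof. by move=> [J [phi [c [Ac ->]]]]; exists J, (Not phi), c. Qed.

Lemma tp_subproof (L : language) (U : structure L) (A : set U) (I : Type)
  (a : vec U I) : is_complete_type A [set D | definable A D /\ D a].
Proof.
split=> [D []//|F _ FP|D defD]; first by exists a => D /FP[].
have [Da|nDa] := pselect (D a); [by left | right; split=> //].
exact: definableC.
Qed.

Definition tp (L : language) (U : structure L) (A : set U) (I : Type)
  (a : vec U I) : types A I := Types (tp_subproof A a).

HB.instance Definition _ (L : language) (U : structure L) (A : set U)
  (I : Type) := gen_eqMixin (types A I).
HB.instance Definition _ (L : language) (U : structure L) (A : set U)
  (I : Type) := gen_choiceMixin (types A I).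
HB.instance Definition _ (L : language) (U : structure L) (A : set U)
  (I : Type) := isPointed.Build (types A I) (tp A point).
HB.instance Definition _ (L : language) (U : structure L) (A : set U)
  (I : Type) := @isSubBaseTopological.Build (types A I) (set (vec U I))
    (definable A (I := I)) (fun D : set (vec U I) => [set p : types A I | p D]).

Notation borel_types A I := (g_sigma_algebraType (@open (types A I))).

Definition realizes (L : language) (U : structure L) (A : set U) (I : Type)
  (b : vec U I) (p : types A I) := forall D, p D -> D b.

(* [p] is a global type and [X] is a type-definable set over small parameters;
   by saturation the choice of the partial type [S] defining [X] is
   irrelevant. *)
Definition implies_set (kappa : Type) (L : language) (U : structure L)
    (I : Type) (p : types [set: U] I) (X : set (vec U I)) :=
  exists (A : set U) (S : set (set (vec U I))),
    [/\ small kappa A, S `<=` definable A (I := I), \bigcap_(D in S) D = X &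
        S `<=` type_set p].

Section Keisler.
Context {R : realType} {L : language} {U : structure L}.

(* Measures are real-valued functions of which only the values at definable
   sets are meaningful; they are compared by [eq_keisler]. *)
Definition is_keisler (I : Type) (mu : set (vec U I) -> R) :=
  [/\ forall D, definable setT D -> 0 <= mu D, mu setT = 1 &
      forall D E, definable setT D -> definable setT E -> D `&` E = set0 ->
        mu (D `|` E) = mu D + mu E].

Definition eq_keisler (I : Type) (mu nu : set (vec U I) -> R) :=
  forall D, definable setT D -> mu D = nu D.

Definition pushfwd (I J : Type) (f : vec U I -> vec U J)
    (mu : set (vec U I) -> R) : set (vec U J) -> R :=
  fun D => mu (f @^-1` D).

Definition supp (I : Type) (mu : set (vec U I) -> R) : set (types [set: U] I) :=
  [set p | forall D, p D -> 0 < mu D].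

Definition type_invariant (A : set U) (I : Type) (mu : set (vec U I) -> R) :=
  forall (J : finType) (D : set (vec U (I + J))), definable set0 D ->
  forall b b' : vec U J, same_type A b b' -> mu (fiber D b) = mu (fiber D b').

(* F^phi_{mu,A}(q) = mu(phi(x,b)) for b |= q *)
Definition Fmap (A : set U) (I J : Type) (mu : set (vec U I) -> R)
    (D : set (vec U (I + J))) (q : borel_types A J) : R :=
  mu (fiber D (xget point [set b : vec U J | realizes b q])).

Definition borel_definable_over (A : set U) (I : Type)
    (mu : set (vec U I) -> R) :=
  type_invariant A mu /\
  forall (J : finType) (D : set (vec U (I + J))), definable set0 D ->
    measurable_fun [set: borel_types A J] (Fmap mu D).

Definition borel_definable (kappa : Type) (I : Type)
    (mu : set (vec U I) -> R) :=
  exists2 A : set U, small kappa A & borel_definable_over A mu.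

(* [P] is the regular Borel probability measure on S_y(A) associated with the
   restriction of [nu] to A *)
Definition regular_extension (A : set U) (J : Type) (nu : set (vec U J) -> R)
    (P : probability (borel_types A J) R) :=
  (forall D, definable A D -> P [set q : types A J | q D] = (nu D)%:E) /\
  (forall B : set (borel_types A J), measurable B ->
    P B = ereal_sup [set P C | C in
      [set C : set (types A J) | closed C /\ C `<=` B]]).

(* For mu Borel-definable, the value does not depend on the choice of a small
   set [A] over which mu is Borel-definable and D is definable. *)
Definition morley (kappa : Type) (I J : Type) (mu : set (vec U I) -> R)
    (nu : set (vec U J) -> R) (D : set (vec U (I + J))) : R :=
  xget 0 [set r | exists A : set U,
    [/\ small kappa A, borel_definable_over A mu, definable A D &
        exists2 P : probability (borel_types A J) R,
          regular_extension nu P &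
          r = \int[P]_(q in setT) Fmap mu D q]].

(* [mpow kappa mu n] is mu^(n+1), in the variables (x_n, ..., x_0) *)
Fixpoint pidx (I : finType) (n : nat) : finType :=
  if n is n'.+1 then ((I + pidx I n')%type : finType) else I.

Fixpoint mpow (kappa : Type) (I : finType) (mu : set (vec U I) -> R) (n : nat) :
    set (vec U (pidx I n)) -> R :=
  match n return set (vec U (pidx I n)) -> R with
  | 0 => mu
  | n'.+1 => morley kappa mu (@mpow kappa I mu n')
  end.
Arguments mpow kappa [I] mu n _.

Fixpoint blocks (I : finType) (n : nat) : vec U (pidx I n) -> seq (vec U I) :=
  match n return vec U (pidx I n) -> seq (vec U I) with
  | 0 => fun a => [:: a]
  | n'.+1 => fun a : vec U (I + pidx I n') => fstv a :: @blocks I n' (sndv a)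
  end.
Arguments blocks [I] n _.

Definition Av (I : Type) (s : seq (vec U I)) (D : set (vec U I)) : R :=
  (\sum_(a <- s) \1_D a) / (size s)%:R.

Definition fim_over (kappa : Type) (M : set U) (I : finType)
    (mu : set (vec U I) -> R) :=
  [/\ borel_definable kappa mu, type_invariant M mu &
    forall (J : finType) (D : set (vec U (I + J))), definable set0 D ->
      exists theta : forall n, set (vec U (pidx I n)),
      [/\ forall n, definable M (theta n),
          mpow kappa mu n (theta n) @[n --> \oo] --> (1 : R) &
          forall eps : R, 0 < eps -> exists n_eps, forall k, (n_eps <= k)%N ->
            forall a : vec U (pidx I k), theta k a ->
            sup (range (fun b : vec U J =>
              `|Av (blocks k a) (fiber D b) - mu (fiber D b)|)) < eps]].

Definition fim (kappa : Type) (I : finType) (mu : set (vec U I) -> R) :=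
  exists M : set U,
    [/\ small kappa M, elementary_substructure M & fim_over kappa M mu].
End Keisler.
Arguments mpow {R L U} kappa [I] mu n _.
Arguments blocks {L U I} n _.

(* A partial type over the empty set, with 0-definable operations which
   restrict to a group structure on its set of realizations in [U]. *)
Record tdgroup (L : language) (U : structure L) (I : finType) := TDGroup {
  gtype : set (set (vec U I));
  gmul : vec U I -> vec U I -> vec U I;
  ginv : vec U I -> vec U I;
  gone : vec U I;
  gtype_def : gtype `<=` definable set0 (I := I);
  gmul_def : definable_fun set0
    (fun z : vec U (I + I) => gmul (fstv z) (sndv z));
  ginv_def : definable_fun set0 ginv;
  gone_def : definable set0 [set gone];
  gpt : set (vec U I) := \bigcap_(D in gtype) D;
  gmul_in : forall x y, gpt x -> gpt y -> gpt (gmul x y);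
  ginv_in : forall x, gpt x -> gpt (ginv x);
  gone_in : gpt gone;
  gmulA : forall x y z, gpt x -> gpt y -> gpt z ->
    gmul x (gmul y z) = gmul (gmul x y) z;
  gmul1 : forall x, gpt x -> gmul x gone = x;
  g1mul : forall x, gpt x -> gmul gone x = x;
  gmulV : forall x, gpt x -> gmul x (ginv x) = gone;
  gVmul : forall x, gpt x -> gmul (ginv x) x = gone }.

Section Group.
Context {R : realType} {L : language} {U : structure L} {I : finType}.
Variable G : tdgroup U I.

Definition abelian_group :=
  forall x y, gpt G x -> gpt G y -> gmul G x y = gmul G y x.

(* mu \in M_G(U) *)
Definition keisler_on (mu : set (vec U I) -> R) :=
  is_keisler mu /\ forall p, supp mu p -> gtype G `<=` type_set p.

Definition stab (mu : set (vec U I) -> R) : set (vec U I) :=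
  [set g | gpt G g /\ eq_keisler (pushfwd (fun x => gmul G x g) mu) mu].

Definition convolution (kappa : Type) (mu nu : set (vec U I) -> R) :
    set (vec U I) -> R :=
  fun D => morley kappa mu nu
    [set z : vec U (I + I) | D (gmul G (fstv z) (sndv z))].

Definition idempotent_measure (kappa : Type) (mu : set (vec U I) -> R) :=
  eq_keisler (convolution kappa mu mu) mu.

(* mpow kappa mu 1 is mu^(2) *)
Definition generically_transitive (kappa : Type) (mu : set (vec U I) -> R) :=
  eq_keisler (mpow kappa mu 1 : set (vec U (I + I)) -> R)
    (pushfwd (fun z : vec U (I + I) => pairv (gmul G (fstv z) (sndv z)) (sndv z))
       (mpow kappa mu 1)).
End Group.

(* Main.v *)
(* For part one, draw (x_n, ..., x_0) from mu^(n+1) and let z = x_n ... x_0.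
   Since mu is idempotent and G is abelian, each pair (z, x_i) is distributed
   as (x_1 x_0, x_0) under mu^(2), while z is distributed as mu.  The law of
   large numbers contained in fim is uniform in the parameter, so it may be
   applied to the formula phi(z, y) although z depends on the sample: the
   frequency of phi(z, x_i) is close to mu(phi(z, y)).  Taking expectations,
   f_*(mu^(2))(phi) = mu^(2)(phi).

   For part two, generic transitivity shows coordinate by coordinate that a
   sample of mu^(n) translated by an independent g has again law mu^(n).  A good
   sample whose translate is good as well forces mu(E(x g, b)) to be close to
   mu(E(x, b)) for all b at once, so g lies in Stab(mu) up to epsilon for
   mu-almost all g; averages over points of M make this an M-definable
   condition.

   The Morley product requires regular Borel extensions on type spaces, which
   are built by a Caratheodory construction from the clopen sets.  All other
   integrals are taken of uniform limits of definable simple functions, where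
   finite additivity suffices. *)
From HB Require Import structures.
Require Import Defs.
From mathcomp Require Import all_boot all_order all_algebra.
From mathcomp Require Import finmap.
From mathcomp Require Import all_classical all_reals all_analysis.
From mathcomp Require Import zify ring lra measurable_realfun.
Import Defs.

Set Implicit Arguments.
Unset Strict Implicit.
Unset Printing Implicit Defensive.

Import Order.TTheory GRing.Theory Num.Theory.
Import numFieldNormedType.Exports.

Local Open Scope classical_set_scope.
Local Open Scope card_scope.
Local Open Scope ring_scope.

(** * Definable sets and functions *)

Section Definability.
Variables (L : language) (U : structure L).

(** Three difficulties shape the proof. The group laws hold only on G(U), while integrands live on
    all of U^x; [E_ext] makes agreement on G(U) sufficient, because by saturation a definable set
    disjoint from G(U) belongs to no support type and is null. Fubini, needed to bring a chosen
    factor next to another one, fails for general definable measures; fim supplies it, since the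
    values mu(phi(x, b)) are, uniformly in b, close to averages over finitely many points. The same
    fact yields definability of mu, and only then do the Morley powers become computable as iterated
    finitely additive integrals. In part two, the formulas E(x, b) and E(x g, b) are sampled
    separately: the average of the second over a sample a is the average of the first over the
    translate a g. Letting the length of the sample grow makes the set of bad g null and not merely
    small, and a null set is avoided by every type in the support. *)

Fixpoint trename (V W : Type) (r : V -> W) (t : term L V) : term L W :=
  match t with
  | Var x => @Var L W (r x)
  | App f ts => @App L W f (fun i => trename r (ts i))
  end.

Fixpoint frename (V W : Type) (r : V -> W) (phi : form L V) : form L W :=
  match phi with
  | Eq s t => Eq (trename r s) (trename r t)
  | Rel a ts => @Rel L W a (fun i => trename r (ts i))
  | Not psi => Not (frename r psi)
  | And psi chi => And (frename r psi) (frename r chi)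
  | Ex psi => Ex (frename (omap r) psi)
  end.

Lemma teval_trename (M : structure L) (V W : Type) (r : V -> W) (t : term L V)
  (v : W -> M) : teval (trename r t) v = teval t (v \o r).
Proof. by elim: t => //= f ts IH; congr fint; apply/funext => i. Qed.

Lemma sat_frename (M : structure L) (V W : Type) (r : V -> W) (phi : form L V)
  (v : W -> M) : sat (frename r phi) v <-> sat phi (v \o r).
Proof.
elim: phi W r v => {V} [V s t|V a ts|V psi IH|V psi IH1 chi IH2|V psi IH] W r v /=.
- by rewrite !teval_trename.
- by rewrite (_ : (fun i => _) = fun i => teval (ts i) (v \o r)) //;
    apply/funext => i; rewrite teval_trename.
- by rewrite IH.
- by rewrite IH1 IH2.
- by split=> -[a Ha]; exists a; move: Ha; rewrite IH;
    rewrite (_ : oapp v a \o omap r = oapp (v \o r) a) //; apply/funext => -[].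
Qed.

(** [Ex] binds a single variable, so a block is quantified one variable at a time: [ord0] becomes
    the bound [None], and [unlift] shifts the other indices. *)
Lemma exists_block (V : Type) (n : nat) (phi : form L ('I_n + V)) :
  exists psi : form L V, forall (M : structure L) (v : V -> M),
    sat psi v <-> exists w : 'I_n -> M,
      sat phi (fun k => match k with inl i => w i | inr j => v j end).
Proof.
elim: n phi => [|n IH] phi.
  exists (frename (fun k : 'I_0 + V => match k with
    | inl i => match notF (ltn_ord i) with end | inr j => j end) phi) => M v.
  rewrite sat_frename; split=> [H|[w H]].
    exists (fun i : 'I_0 => match notF (ltn_ord i) with end).
    by congr (sat phi _): H; apply/funext => -[[]|].
  by congr (sat phi _): H; apply/funext => -[[]|].
pose r (k : 'I_n.+1 + V) : option ('I_n + V) := match k with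
  | inl i => omap inl (unlift ord0 i) | inr j => Some (inr j) end.
have [psi Hpsi] := IH (Ex (frename r phi)).
exists psi => M v; rewrite Hpsi /=; split=> [[w [a]]|[w H]].
  rewrite sat_frename => H.
  exists (fun i => oapp w a (unlift ord0 i)).
  by congr (sat phi _): H; apply/funext => -[i|j] //=; case: unliftP.
exists (fun i => w (lift ord0 i)), (w ord0); rewrite sat_frename.
congr (sat phi _): H; apply/funext => -[i|j] //=.
by case: unliftP => [k|] ->.
Qed.

Lemma exists_fin (V : Type) (K : finType) (phi : form L (V + K)) :
  exists psi : form L V, forall (M : structure L) (v : V -> M),
    sat psi v <-> exists w : K -> M,
      sat phi (fun k => match k with inl i => v i | inr j => w j end).
Proof.
have [psi Hpsi] := exists_block (frename (fun k : V + K => match k with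
  | inl i => inr i | inr j => inl (enum_rank j) end) phi).
exists psi => M v; rewrite Hpsi; split=> -[w]; rewrite ?sat_frename => H.
  exists (w \o enum_rank).
  by congr (sat phi _): H; apply/funext => -[].
exists (w \o enum_val); rewrite sat_frename.
by congr (sat phi _): H; apply/funext => -[//|j] /=; rewrite enum_rankK.
Qed.

Section Over.
Variable A : set U.

Lemma definable_ext (I : Type) (D E : set (vec U I)) :
  (forall x, D x <-> E x) -> definable A D -> definable A E.
Proof. by move=> DE; rewrite (_ : D = E)//; apply/seteqP; split=> x /DE. Qed.

Lemma definable_reindex (I K : Type) (r : I -> K) (D : set (vec U I)) :
  definable A D -> definable A [set z : vec U K | D (z \o r)].
Proof.
move=> [J [phi [c [Ac ->]]]].
exists J, (frename (fun k => match k with inl i => inl (r i) | inr j => inr j end) phi), c.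
split=> //; apply/seteqP; split=> z /=; rewrite sat_frename => H;
  by congr (sat phi _): H; apply/funext => -[].
Qed.

Lemma definableI (I : Type) (D E : set (vec U I)) :
  definable A D -> definable A E -> definable A (D `&` E).
Proof.
move=> [J [phi [c [Ac ->]]]] [K [psi [d [Ad ->]]]].
exists (J + K)%type, (And
  (frename (fun k => match k with inl i => inl i | inr j => inr (inl j) end) phi)
  (frename (fun k => match k with inl i => inl i | inr j => inr (inr j) end) psi)),
  (pairv c d).
split=> [[]//|]; apply/seteqP; split=> z /=; rewrite !sat_frename => -[H1 H2];
  by split; [congr (sat phi _): H1|congr (sat psi _): H2]; apply/funext => -[].
Qed.

Lemma definableU (I : Type) (D E : set (vec U I)) :
  definable A D -> definable A E -> definable A (D `|` E).
Proof.
move=> dD dE; rewrite -[_ `|` _]setCK setCU.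
by apply/definableC/definableI; apply/definableC.
Qed.

Lemma definable_coord (I : Type) (i j : I) :
  definable A [set z : vec U I | z i = z j].
Proof.
exists void, (Eq (@Var L (I + void)%type (inl i)) (@Var L (I + void)%type (inl j))),
  (of_void _).
by split=> [[]|].
Qed.

(** The empty conjunction needs a true formula; [i0] supplies it as the equation of a coordinate
    with itself. *)
Lemma definable_all (I : Type) (K : finType) (D : K -> set (vec U I)) (i0 : I) :
  (forall k, definable A (D k)) -> definable A [set z | forall k, D k z].
Proof.
move=> dD.
suff H (s : seq K) : definable A [set z | forall k, k \in s -> D k z].
  apply: definable_ext (H (enum K)) => z; split=> Hz k; last by move=> _.
  by apply: Hz; rewrite mem_enum.
elim: s => [|k s IH].
  by apply: definable_ext (definable_coord i0 i0) => z; split.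
apply: definable_ext (definableI (dD k) IH) => z; split=> [[Hk Hs] l|Hz].
  by rewrite inE => /predU1P [->//|/Hs].
by split=> [|l ls]; apply: Hz; rewrite inE ?eqxx ?ls ?orbT.
Qed.

Lemma definable_param (I : Type) (K : finType) (D : set (vec U (K + I)))
    (c : vec U K) :
  (forall k, A (c k)) -> definable A D -> definable A [set x | D (pairv c x)].
Proof.
move=> Ac [J [phi [d [Ad ->]]]].
exists (K + J)%type, (frename (fun k => match k with
  | inl (inl k) => inr (inl k) | inl (inr i) => inl i | inr j => inr (inr j) end) phi),
  (pairv c d).
split=> [[]//|]; apply/seteqP; split=> z /=; rewrite sat_frename => H;
  by congr (sat phi _): H; apply/funext => -[[]|].
Qed.

Lemma definable_ex (I : Type) (K : finType) (D : set (vec U (I + K))) :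
  definable A D -> definable A [set x | exists y, D (pairv x y)].
Proof.
move=> [J [phi [c [Ac ->]]]].
have [psi Hpsi] := exists_fin (frename (fun k : I + K + J => match k with
  | inl (inl i) => inl (inl i) | inl (inr k) => inr k | inr j => inl (inr j) end) phi).
exists J, psi, c; split=> //; apply/seteqP; split=> z /=; rewrite Hpsi => -[w H];
  exists w; move: H; rewrite sat_frename => H;
  by congr (sat phi _): H; apply/funext => -[[]|].
Qed.

Lemma definable_forall (I : Type) (K : finType) (D : set (vec U (I + K))) :
  definable A D -> definable A [set x | forall y, D (pairv x y)].
Proof.
move=> /definableC /definable_ex /definableC; apply: definable_ext => x /=.
by split=> [H y|H [y]]; [apply: contrapT => nD; apply: H; exists y|apply].
Qed.

End Over.

Lemma definable_mono (A B : set U) (I : Type) (D : set (vec U I)) :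
  A `<=` B -> definable A D -> definable B D.
Proof.
move=> AB [J [phi [c [Ac ->]]]]; exists J, phi, c; split=> // j.
exact/AB/Ac.
Qed.

(** Separates parameters from formulas: [type_invariant] and fim speak of formulas over the empty
    set, and are extended in this way to formulas with parameters. *)
Lemma definable_set0_fiber (A : set U) (I : Type) (D : set (vec U I)) :
  definable A D -> exists (J : finType) (E : set (vec U (I + J))) (c : vec U J),
    [/\ definable set0 E, (forall j, A (c j)) & D = fiber E c].
Proof.
move=> [J [phi [c [Ac ->]]]]; exists J, [set z | sat phi z], c; split=> //.
exists void, (frename inl phi), (of_void _); split=> [[]|].
apply/seteqP; split=> z /=; rewrite sat_frename => H;
  by congr (sat phi _): H; apply/funext => -[].
Qed.

Section DefinableFun.
Variable A : set U.

Lemma definable_preim (I : Type) (K : finType) (f : vec U I -> vec U K)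
    (D : set (vec U K)) :
  definable_fun A f -> definable A D -> definable A (f @^-1` D).
Proof.
move=> df dD.
have := definable_ex (definableI df (definable_reindex inr dD)).
apply: definable_ext => x; split=> [[y [e Dy]]|Dfx].
  by rewrite /preimage /mkset -(e : y = f x).
by exists (f x); split.
Qed.

Lemma definable_fun_reindex (I : Type) (K : finType) (r : K -> I) :
  definable_fun A (fun x : vec U I => x \o r : vec U K).
Proof.
have [i0|noK] := pselect (inhabited (I + K)%type).
  case: i0 => i0.
  have := @definable_all A _ K (fun k => [set z | z (inr k) = z (inl (r k))]) i0.
  move=> /(_ (fun k => definable_coord _ _ _)); apply: definable_ext => z.
  split=> [H|H k]; first by apply/funext => k; exact: H.
  exact: (congr1 (@^~ k) H).
(* Without variables the true formula has to be a sentence: no element differs from itself. Here [K]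
   is empty, so all tuples indexed by it are equal. *)
exists void, (Not (Ex (Not (Eq (@Var L (option (I + K + void)) None) (@Var L (option (I + K + void)) None))))), (of_void _).
split=> [[]//|]; apply/seteqP; split=> z /= _; first by case.
by apply/funext => k; case: noK; split; right.
Qed.

Lemma definable_fun_pair (I : Type) (J K : finType) (f : vec U I -> vec U J)
    (g : vec U I -> vec U K) : definable_fun A f -> definable_fun A g ->
  definable_fun A (fun x => pairv (f x) (g x)).
Proof.
move=> df dg.
have := definableI
  (definable_reindex (fun k => match k with inl i => inl i | inr j => inr (inl j) end : I + (J + K)) df)
  (definable_reindex (fun k => match k with inl i => inl i | inr j => inr (inr j) end : I + (J + K)) dg).
apply: definable_ext => z; rewrite /sndv /fstv; split=> [[/= H1 H2]|/= H].
  by apply/funext => -[j|k]; [exact: (congr1 (@^~ j) H1)|exact: (congr1 (@^~ k) H2)].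
by split; apply/funext => k; [have := congr1 (@^~ (inl k)) H|have := congr1 (@^~ (inr k)) H].
Qed.

Lemma definable_fun_comp (I : Type) (J K : finType) (f : vec U I -> vec U J)
    (g : vec U J -> vec U K) : definable_fun A f -> definable_fun A g ->
  definable_fun A (g \o f).
Proof.
move=> df dg.
have := definable_ex (definableI
  (definable_reindex (fun k => match k with inl i => inl (inl i) | inr j => inr j end : (I + K) + J) df)
  (definable_reindex (fun k => match k with inl i => inr i | inr j => inl (inr j) end : (I + K) + J) dg)).
apply: definable_ext => z; split=> [[y [e1 e2]]|H].
  by have := e2 : sndv z = g y; rewrite (e1 : y = f (fstv z)).
by exists (f (fstv z)); split.
Qed.

Lemma definable_fun_cst (I : Type) (K : finType) (c : vec U K) :
  (forall k, A (c k)) -> definable_fun A (fun _ : vec U I => c).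
Proof.
move=> Ac; have := definable_param Ac (@definable_fun_reindex K K id).
by move=> /(definable_reindex (inr : K -> I + K)); apply: definable_ext.
Qed.

Lemma definable_funW (B : set U) (I J : Type) (f : vec U I -> vec U J) :
  B `<=` A -> definable_fun B f -> definable_fun A f.
Proof. exact: definable_mono. Qed.

Lemma definable_fun_fst (I : finType) (J : Type) :
  definable_fun A (@fstv L U I J).
Proof. exact: definable_fun_reindex. Qed.

Lemma definable_fun_snd (I : Type) (J : finType) :
  definable_fun A (@sndv L U I J).
Proof. exact: definable_fun_reindex. Qed.

Lemma definable_fun_id (I : finType) : definable_fun A (@id (vec U I)).
Proof. exact: (definable_fun_reindex id). Qed.

Lemma definableT (I : Type) : definable A [set: vec U I].
Proof.
exists void, (Not (Ex (Not (Eq (@Var L (option (I + void)) None) (@Var L (option (I + void)) None))))), (of_void _).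
by split=> [[]//|]; apply/seteqP; split=> z //= _; case.
Qed.

Lemma definable0 (I : Type) : definable A (set0 : set (vec U I)).
Proof. by rewrite -setCT; apply/definableC/definableT. Qed.

End DefinableFun.

(** Tarski-Vaught for tuples: that [D] is nonempty is a first-order statement about its parameters,
    and these lift to [N] along [h]. *)
Lemma elementary_substructure_meets (M : set U) (I : finType) (D : set (vec U I)) :
  elementary_substructure M -> definable M D -> D !=set0 ->
  exists2 x, D x & forall i, M (x i).
Proof.
move=> [N [h [hM hN]]] [J [phi [c [Mc ->]]]] [x /= Dx].
have Mc' j : exists d, h d = c j by have := Mc j; rewrite -hM => -[d]; exists d.
have [d hd] := choice Mc'.
have [psi Hpsi] := exists_fin (frename (fun k : I + J => match k with
  | inl i => inr i | inr j => inl j end) phi).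
have : sat psi c.
  apply/Hpsi; exists x; rewrite sat_frename.
  by congr (sat phi _): Dx; apply/funext => -[].
rewrite (_ : c = h \o d); last by apply/funext => j; rewrite /= hd.
rewrite -hN Hpsi => -[w]; rewrite sat_frename hN => H.
exists (h \o w); last by move=> i; rewrite -hM; exists (w i).
congr (sat phi _): H; apply/funext => -[] //= j.
Qed.

End Definability.

(** * Finitely additive integration of definable simple functions *)

Section Integration.
Variables (R : realType) (L : language) (U : structure L).

(* A list of pairs [(c, D)] stands for the simple function [sum c * 1_D]. *)
Definition simple (J : Type) := seq (R * set (vec U J)).

Definition seval (J : Type) (s : simple J) (x : vec U J) : R :=
  \sum_(p <- s) p.1 * \1_(p.2) x.

Definition smass (J : Type) (nu : set (vec U J) -> R) (s : simple J) : R :=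
  \sum_(p <- s) p.1 * nu p.2.

Fixpoint dsimple (A : set U) (J : Type) (s : simple J) : Prop :=
  if s is p :: s' then definable A p.2 /\ dsimple A s' else True.

(** Uniform closure of the definable simple functions, that is, the functions which factor through a
    continuous function on S_y(A). *)
Definition approx (A : set U) (J : Type) (h : vec U J -> R) :=
  forall e, 0 < e -> exists2 s, dsimple A s & forall x, `|h x - seval s x| <= e.

(** A lower integral. The laws of an integral are established for integrands in the closure
    [approx setT]. *)
Definition kint (J : Type) (nu : set (vec U J) -> R) (h : vec U J -> R) : R :=
  sup [set r | exists s, [/\ dsimple setT s, forall x, seval s x <= h x &
                             r = smass nu s]].

Lemma dsimple_cat A J (s t : simple J) :
  dsimple A s -> dsimple A t -> dsimple A (s ++ t).
Proof. by move=> + dt; elim: s => //= p s IH [dp /IH]. Qed.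

Lemma seval_cat J (s t : simple J) x : seval (s ++ t) x = seval s x + seval t x.
Proof. by rewrite /seval big_cat. Qed.

Lemma smass_cat J nu (s t : simple J) : smass nu (s ++ t) = smass nu s + smass nu t.
Proof. by rewrite /smass big_cat. Qed.

Definition sscale J (c : R) (s : simple J) : simple J :=
  [seq (c * p.1, p.2) | p <- s].

Lemma dsimple_scale A J c (s : simple J) : dsimple A s -> dsimple A (sscale c s).
Proof. by elim: s => //= p s IH [dp /IH]. Qed.

Lemma seval_scale J c (s : simple J) x : seval (sscale c s) x = c * seval s x.
Proof.
by rewrite /seval big_map mulr_sumr; apply: eq_bigr => p _; rewrite mulrA.
Qed.

Lemma smass_scale J nu c (s : simple J) : smass nu (sscale c s) = c * smass nu s.
Proof.
by rewrite /smass big_map mulr_sumr; apply: eq_bigr => p _; rewrite mulrA.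
Qed.

Definition scomp J K (f : vec U J -> vec U K) (s : simple K) : simple J :=
  [seq (p.1, f @^-1` p.2) | p <- s].

Lemma dsimple_comp A J (K : finType) (f : vec U J -> vec U K) s :
  definable_fun A f -> dsimple A s -> dsimple A (scomp f s).
Proof.
by move=> df; elim: s => //= p s IH [dp /IH]; split=> //; apply: definable_preim.
Qed.

Lemma seval_comp J K (f : vec U J -> vec U K) s x :
  seval (scomp f s) x = seval s (f x).
Proof. by rewrite /seval big_map. Qed.

Lemma dsimple_mono A B J (s : simple J) : A `<=` B -> dsimple A s -> dsimple B s.
Proof.
by move=> AB; elim: s => //= p s IH [dp /IH]; split=> //; apply: definable_mono dp.
Qed.

Section Approx.
Variable A : set U.

Lemma approx_indic J (D : set (vec U J)) : definable A D -> approx A (\1_D).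
Proof.
move=> dD e e0; exists [:: (1, D)] => //= x.
by rewrite /seval big_seq1 mul1r subrr normr0 ltW.
Qed.

Lemma approx_cst J c : approx A (fun _ : vec U J => c).
Proof.
move=> e e0; exists [:: (c, setT)]; first by split=> //; apply: definableT.
by move=> x; rewrite /seval big_seq1 /= indicT mulr1 subrr normr0 ltW.
Qed.

Lemma approxD J (f g : vec U J -> R) : approx A f -> approx A g ->
  approx A (fun x => f x + g x).
Proof.
move=> af ag e e0; have e2 : 0 < e / 2 by rewrite divr_gt0.
have [s ds Hs] := af _ e2; have [t dt Ht] := ag _ e2.
exists (s ++ t) => [|x]; first exact: dsimple_cat.
rewrite seval_cat; have := Hs x; have := Ht x; rewrite !ler_norml => ? ?; lra.
Qed.

Lemma approxZ J c (f : vec U J -> R) : approx A f -> approx A (fun x => c * f x).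
Proof.
move=> af e e0; have c0 : 0 < `|c| + 1 by rewrite ltr_wpDl.
have [s ds Hs] := af _ (divr_gt0 e0 c0).
exists (sscale c s) => [|x]; first exact: dsimple_scale.
rewrite seval_scale -mulrBr normrM.
apply: (@le_trans _ _ ((`|c| + 1) * (e / (`|c| + 1)))).
  by apply: ler_pM => //; rewrite lerDl.
by rewrite mulrCA divff ?mulr1 // gt_eqF.
Qed.

Lemma approxB J (f g : vec U J -> R) : approx A f -> approx A g ->
  approx A (fun x => f x - g x).
Proof.
move=> af /(approxZ (-1)) /(approxD af).
by congr approx; apply/funext => x; rewrite mulN1r.
Qed.

Lemma approx_sum J (T : Type) (r : seq T) (F : T -> vec U J -> R) :
  (forall i, approx A (F i)) -> approx A (fun x => \sum_(i <- r) F i x).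
Proof.
move=> aF; elim: r => [|i r IH].
  by under eq_fun do rewrite big_nil; apply: approx_cst.
by under eq_fun do rewrite big_cons; apply: approxD.
Qed.

Lemma approx_seval J (s : simple J) : dsimple A s -> approx A (seval s).
Proof. by move=> ds e e0; exists s => // x; rewrite subrr normr0 ltW. Qed.

Lemma approx_comp J (K : finType) (f : vec U J -> vec U K) h :
  definable_fun A f -> approx A h -> approx A (fun x => h (f x)).
Proof.
move=> df ah e /ah [s ds Hs]; exists (scomp f s); first exact: dsimple_comp.
by move=> x; rewrite seval_comp.
Qed.

Lemma approx_lim J (h : vec U J -> R) :
  (forall e, 0 < e -> exists2 g, approx A g & forall x, `|h x - g x| <= e) ->
  approx A h.
Proof.
move=> H e e0; have e2 : 0 < e / 2 by rewrite divr_gt0.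
have [g ag Hg] := H _ e2; have [s ds Hs] := ag _ e2; exists s => // x.
have := Hs x; have := Hg x; rewrite !ler_norml => ? ?; lra.
Qed.

(** Peeling off a summand [c * 1_D] lowers the threshold by [c] on [D] and keeps it off [D]. *)
Lemma definable_seval_gt J (s : simple J) t :
  dsimple A s -> definable A [set x | t < seval s x].
Proof.
elim: s t => [|[c D] s IH] t /= => [_|[dD ds]].
  have [t0|t0] := boolP (t < 0).
    apply: definable_ext (definableT A J) => x; rewrite /= /seval big_nil.
    by split.
  apply: definable_ext (definable0 A J) => x; rewrite /= /seval big_nil.
  by split=> //; apply/negP.
apply: definable_ext (definableU (definableI dD (IH (t - c) ds))
  (definableI (definableC dD) (IH t ds))) => x.
rewrite /= /seval big_cons -/(seval s x) /= indicE.
have [xD|xD] := boolP (x \in D).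
  have Dx := set_mem xD; rewrite mulr1 ltrBlDl; split=> [[[]//|[]//]|]; by left.
have nDx : ~ D x by move=> /mem_set; apply/negP.
rewrite mulr0 add0r; split=> [[[]//|[]//]|]; by right.
Qed.

End Approx.

(* [Phi] is only constrained on functions in the uniform closure of the
   definable simple functions. *)
Record positive_functional (J : Type) (Phi : (vec U J -> R) -> R) := {
  pfD : forall f g, approx setT f -> approx setT g ->
    Phi (fun x => f x + g x) = Phi f + Phi g;
  pfZ : forall c f, approx setT f -> Phi (fun x => c * f x) = c * Phi f;
  pf_le : forall f g, approx setT f -> approx setT g ->
    (forall x, f x <= g x) -> Phi f <= Phi g;
  pf1 : Phi (fun=> 1) = 1 }.

Section PositiveFunctional.
Variables (J : Type) (Phi : (vec U J -> R) -> R).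
Hypothesis Phi_pf : positive_functional Phi.

Lemma pf_cst c : Phi (fun=> c) = c.
Proof.
rewrite -[RHS]mulr1 -[X in _ = c * X](pf1 Phi_pf) -(pfZ Phi_pf c (approx_cst setT J 1)).
by congr Phi; apply/funext => x; rewrite mulr1.
Qed.

Lemma pfB f g : approx setT f -> approx setT g ->
  Phi (fun x => f x - g x) = Phi f - Phi g.
Proof.
move=> af ag; rewrite -mulN1r -(pfZ Phi_pf _ ag) -(pfD Phi_pf) //; last exact: approxZ.
by congr Phi; apply/funext => x; rewrite mulN1r.
Qed.

Lemma pf_sum (T : Type) (r : seq T) (F : T -> vec U J -> R) :
  (forall i, approx setT (F i)) ->
  Phi (fun x => \sum_(i <- r) F i x) = \sum_(i <- r) Phi (F i).
Proof.
move=> aF; elim: r => [|i r IH].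
  by under eq_fun do rewrite big_nil; rewrite pf_cst big_nil.
under eq_fun do rewrite big_cons.
by rewrite (pfD Phi_pf) ?IH ?big_cons //; apply: approx_sum.
Qed.

Lemma pf_close f g e : approx setT f -> approx setT g ->
  (forall x, `|f x - g x| <= e) -> `|Phi f - Phi g| <= e.
Proof.
move=> af ag H.
have ae := @approx_cst setT J e.
have l1 : Phi f <= Phi g + e.
  rewrite -[X in _ <= _ + X](pf_cst e) -(pfD Phi_pf) //; apply: (pf_le Phi_pf) => //.
    exact: approxD.
  by move=> x; have := H x; rewrite ler_norml => ?; lra.
have l2 : Phi g <= Phi f + e.
  rewrite -[X in _ <= _ + X](pf_cst e) -(pfD Phi_pf) //; apply: (pf_le Phi_pf) => //.
    exact: approxD.
  by move=> x; have := H x; rewrite ler_norml => ?; lra.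
by rewrite ler_norml; lra.
Qed.

Lemma pf_seval s : dsimple setT s ->
  Phi (seval s) = smass (fun D => Phi (\1_D)) s.
Proof.
elim: s => [|[c D] s IH] /= => [_|[dD ds]].
  rewrite /smass big_nil -[RHS](pf_cst 0); congr Phi.
  by apply/funext => x; rewrite /seval big_nil.
rewrite /smass big_cons -/(smass (fun D => Phi (\1_D)) s) -IH //= -(pfZ Phi_pf); last exact: approx_indic.
rewrite -(pfD Phi_pf); [|apply: approxZ; exact: approx_indic|exact: approx_seval].
by congr Phi; apply/funext => x; rewrite /seval big_cons.
Qed.

End PositiveFunctional.

Lemma eq_small (x y : R) : (forall e, 0 < e -> `|x - y| <= e) -> x = y.
Proof.
move=> H; apply/eqP; rewrite -subr_eq0 -normr_le0.
by apply/ler_addgt0Pl => e /H; rewrite addr0.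
Qed.

(** Reduces identities between integrals to definable sets: both functionals are 1-Lipschitz for the
    uniform distance, so agreement on indicators passes to the closure. *)
Lemma pf_ext J (Phi Psi : (vec U J -> R) -> R) :
  positive_functional Phi -> positive_functional Psi ->
  (forall D, definable setT D -> Phi (\1_D) = Psi (\1_D)) ->
  forall f, approx setT f -> Phi f = Psi f.
Proof.
move=> pPhi pPsi H f af; apply: eq_small => e e0.
have e2 : 0 < e / 2 by rewrite divr_gt0.
have [s ds Hs] := af _ e2.
have : Phi (seval s) = Psi (seval s).
  rewrite !pf_seval //; elim: s ds {Hs} => [|[c D] s IH] /= => [_|[dD ds]].
    by rewrite /smass !big_nil.
  by rewrite /smass !big_cons /= H //; congr (_ + _); exact: IH.
have := pf_close pPhi af (approx_seval ds) Hs.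
have := pf_close pPsi af (approx_seval ds) Hs.
rewrite !ler_norml => ? ? ?; lra.
Qed.

Section Keisler.
Variables (J : Type) (nu : set (vec U J) -> R).
Hypothesis nuK : is_keisler nu.

Let nu_ge0 D : definable setT D -> 0 <= nu D. Proof. by case: nuK => + _ _; apply. Qed.
Let nuT : nu setT = 1. Proof. by case: nuK. Qed.

Lemma keisler0 : nu set0 = 0.
Proof.
case: nuK => _ _ /(_ set0 set0); rewrite setI0 setU0.
by move=> /(_ (definable0 _ _) (definable0 _ _) erefl) ?; lra.
Qed.

Lemma keisler_split C D : definable setT C -> definable setT D ->
  nu C = nu (C `&` D) + nu (C `&` ~` D).
Proof.
move=> dC dD; case: nuK => _ _ <-.
- by rewrite -setIUr setUCr setIT.
- exact: definableI.
- by apply: definableI => //; apply: definableC.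
- by rewrite setIACA setICr setI0.
Qed.

Lemma keislerC D : definable setT D -> nu (~` D) = 1 - nu D.
Proof.
by move=> dD; have := keisler_split (definableT _ _) dD; rewrite !setTI nuT => ?; lra.
Qed.

Lemma keisler_le C D : definable setT C -> definable setT D -> C `<=` D -> nu C <= nu D.
Proof.
move=> dC dD CD; rewrite (keisler_split dD dC) setIidr // lerDl.
by apply/nu_ge0/definableI => //; apply: definableC.
Qed.

Lemma keisler_le1 D : definable setT D -> nu D <= 1.
Proof. by move=> dD; rewrite -nuT; apply: keisler_le => //; apply: definableT. Qed.

(** The sets in [s] may overlap, so the induction cuts [C] along the head set: the rest of the list
    is bounded below by [t - c] inside it and by [t] outside. Consequently [smass] respects the
    pointwise order and depends only on the function represented. *)
Lemma smass_lower C t s : definable setT C -> dsimple setT s ->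
  (forall x, C x -> t <= seval s x) ->
  t * nu C <= \sum_(p <- s) p.1 * nu (C `&` p.2).
Proof.
elim: s C t => [|[c D] s IH] C t dC /= => [_ H|[dD ds] H].
  (* On an empty piece the hypothesis says nothing about [t], but the measure is zero. *)
  rewrite big_nil; have [->|/set0P [x Cx]] := eqVneq C set0.
    by rewrite keisler0 mulr0.
  by rewrite mulr_le0_ge0 ?nu_ge0 //; have := H x Cx; rewrite /seval big_nil.
rewrite big_cons /= (keisler_split dC dD).
have dCD := definableI dC dD; have dCD' := definableI dC (definableC dD).
have h1 := IH _ (t - c) dCD ds _.
have h2 := IH _ t dCD' ds _.
have -> : \sum_(p <- s) p.1 * nu (C `&` p.2) =
  \sum_(p <- s) p.1 * nu (C `&` D `&` p.2) +
  \sum_(p <- s) p.1 * nu (C `&` ~` D `&` p.2).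
  rewrite -big_split /=; elim: s ds {IH h1 h2 H} => [|p s IH] /= => [_|[dp ds]].
    by rewrite !big_nil.
  rewrite !big_cons IH // (keisler_split (definableI dC dp) dD) -mulrDr.
  by rewrite ![_ `&` p.2 `&` _]setIAC.
have {}h1 : (t - c) * nu (C `&` D) <= \sum_(p <- s) p.1 * nu (C `&` D `&` p.2).
  apply: h1 => x [Cx Dx]; have := H x Cx.
  by rewrite /seval big_cons /= indicE mem_set // mulr1 lerBlDl.
have {}h2 : t * nu (C `&` ~` D) <= \sum_(p <- s) p.1 * nu (C `&` ~` D `&` p.2).
  apply: h2 => x [Cx Dx]; have := H x Cx.
  by rewrite /seval big_cons /= indicE memNset // mulr0 add0r.
lra.
Qed.

Lemma smass_ge s t : dsimple setT s -> (forall x, t <= seval s x) -> t <= smass nu s.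
Proof.
move=> ds H; have := @smass_lower setT t s (definableT _ _) ds (fun x _ => H x).
by rewrite nuT mulr1; under eq_bigr do rewrite setTI.
Qed.

Lemma smass_close s t e : dsimple setT s -> dsimple setT t ->
  (forall x, seval s x <= seval t x + e) -> smass nu s <= smass nu t + e.
Proof.
move=> ds dt H.
have := @smass_ge (t ++ sscale (-1) s) (- e) _ _.
rewrite smass_cat smass_scale => h.
suff : - e <= smass nu t + -1 * smass nu s by lra.
apply: h => [|x]; first by apply: dsimple_cat => //; apply: dsimple_scale.
by rewrite seval_cat seval_scale; have := H x; lra.
Qed.

Lemma kint_close s h e : dsimple setT s ->
  (forall x, `|h x - seval s x| <= e) -> `|kint nu h - smass nu s| <= e.
Proof.
move=> ds H.
(* [s'] represents [s - e], which lies below [h] and so competes in the supremum. *)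
pose s' : simple J := (- e, setT) :: s.
have ds' : dsimple setT s' by split=> //; apply: definableT.
have es' x : seval s' x = seval s x - e.
  by rewrite /seval big_cons /= indicT mulr1 addrC.
have ms' : smass nu s' = smass nu s - e by rewrite /smass big_cons /= nuT mulr1 addrC.
set X := [set r | exists s, [/\ dsimple setT s, forall x, seval s x <= h x &
                             r = smass nu s]].
have Xs' : X (smass nu s').
  by exists s'; split=> // x; rewrite es'; have := H x; rewrite ler_norml; lra.
have ubX : ubound X (smass nu s + e).
  move=> r [t [dt Ht ->]]; apply: smass_close => // x.
  by have := H x; have := Ht x; rewrite ler_norml; lra.
have l1 : smass nu s' <= kint nu h.
  by apply: ub_le_sup => //; exists (smass nu s + e).
have l2 : kint nu h <= smass nu s + e.
  by apply: ge_sup => //; exists (smass nu s').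
by rewrite ler_norml; lra.
Qed.

Lemma kint_seval s : dsimple setT s -> kint nu (seval s) = smass nu s.
Proof.
move=> ds; apply: eq_small => e e0; apply: kint_close => // x.
by rewrite subrr normr0 ltW.
Qed.

Lemma kint_indic D : definable setT D -> kint nu (\1_D) = nu D.
Proof.
move=> dD; rewrite (_ : \1_D = seval [:: (1, D)]).
  by rewrite kint_seval // /smass big_seq1 mul1r.
by apply/funext => x; rewrite /seval big_seq1 mul1r.
Qed.

Lemma kint_pf : positive_functional (kint nu).
Proof.
split.
- move=> f g af ag; apply: eq_small => e e0.
  have e4 : 0 < e / 4 by rewrite divr_gt0.
  have [s ds Hs] := af _ e4; have [t dt Ht] := ag _ e4.
  have H x : `|(f x + g x) - seval (s ++ t) x| <= e / 2.
    by rewrite seval_cat; have := Hs x; have := Ht x; rewrite !ler_norml; lra.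
  have := kint_close (dsimple_cat ds dt) H.
  have := kint_close ds Hs; have := kint_close dt Ht.
  by rewrite smass_cat !ler_norml; lra.
- move=> c f af; apply: eq_small => e e0.
  have c0 : 0 < `|c| + 1 by rewrite ltr_wpDl.
  have d0 : 0 < e / (`|c| + 1) / 2 by rewrite !divr_gt0.
  have [s ds Hs] := af _ d0.
  have cb (z : R) : `|z| <= e / (`|c| + 1) / 2 -> `|c * z| <= e / 2.
    move=> hz; rewrite normrM.
    apply: (@le_trans _ _ ((`|c| + 1) * (e / (`|c| + 1) / 2))).
      by apply: ler_pM => //; rewrite lerDl.
    by rewrite -mulrA mulrCA (mulrA _ _ 2^-1) divff ?mul1r // gt_eqF.
  have H x : `|c * f x - seval (sscale c s) x| <= e / 2.
    by rewrite seval_scale -mulrBr; apply: cb.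
  have := kint_close (dsimple_scale c ds) H; rewrite smass_scale.
  have := cb _ (kint_close ds Hs); rewrite mulrBr !ler_norml; lra.
- move=> f g af ag fg; apply/ler_addgt0Pl => e e0.
  have e4 : 0 < e / 4 by rewrite divr_gt0.
  have [s ds Hs] := af _ e4; have [t dt Ht] := ag _ e4.
  have : smass nu s <= smass nu t + e / 2.
    apply: smass_close => // x; have := Hs x; have := Ht x; have := fg x.
    by rewrite !ler_norml; lra.
  have := kint_close ds Hs; have := kint_close dt Ht.
  by rewrite !ler_norml; lra.
- by have := kint_indic (definableT _ J); rewrite nuT indicT.
Qed.

End Keisler.

(* The usual notion of a definable measure, over unspecified parameters. *)
Definition definable_measure (I : finType) (mu : set (vec U I) -> R) :=
  forall (J : finType) (D : set (vec U (I + J))), definable setT D ->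
    approx setT (fun b => mu (fiber D b)).

Lemma definable_fun_pairl A (I J : finType) (y : vec U J) : (forall j, A (y j)) ->
  definable_fun A (fun x : vec U I => pairv x y).
Proof.
move=> Ay; apply: (definable_fun_pair (f := id) (g := fun=> y)).
  exact: definable_fun_id.
exact: definable_fun_cst.
Qed.

Lemma definable_fiber A (I J : finType) (D : set (vec U (I + J))) (y : vec U J) :
  (forall j, A (y j)) -> definable A D -> definable A (fiber D y).
Proof. by move=> Ay; apply/definable_preim/definable_fun_pairl. Qed.

Lemma approx_fiber (I J : finType) (h : vec U (I + J) -> R) (y : vec U J) :
  approx setT h -> approx setT (fun x : vec U I => h (pairv x y)).
Proof. by apply/approx_comp/definable_fun_pairl. Qed.

(** * Iterated integrals *)

Section Iterate.
Variables (I : finType) (mu : set (vec U I) -> R).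
Hypotheses (muK : is_keisler mu) (mud : definable_measure mu).
Let mup := kint_pf muK.

Lemma kint_fiber (J : finType) (D : set (vec U (I + J))) y : definable setT D ->
  kint mu (fun x => \1_D (pairv x y)) = mu (fiber D y).
Proof.
move=> dD; rewrite -(kint_indic muK); last exact: definable_fiber.
by congr kint; apply/funext => x; rewrite !indicE.
Qed.

(** Definability of [mu] concerns indicators only; linearity and uniform limits extend it, so that
    the outer of two integrals is applied to an admissible function. *)
Lemma approx_kint (J : finType) (h : vec U (I + J) -> R) : approx setT h ->
  approx setT (fun y => kint mu (fun x => h (pairv x y))).
Proof.
move=> ah; apply: approx_lim => e /ah [s ds Hs].
exists (fun y => kint mu (fun x => seval s (pairv x y))); last first.
  move=> y; apply: (pf_close mup) => //; first exact: approx_fiber.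
  exact/approx_fiber/approx_seval.
elim: s ds {Hs} => [|[c D] s IH] /= => [_|[dD ds]].
  rewrite (_ : (fun y => _) = fun=> 0); first exact: approx_cst.
  apply/funext => y; rewrite (_ : (fun x => _) = fun=> 0) ?(pf_cst mup) //.
  by apply/funext => x; rewrite /seval big_nil.
rewrite (_ : (fun y => _) = fun y =>
  c * mu (fiber D y) + kint mu (fun x => seval s (pairv x y))).
  by apply: approxD; [apply: approxZ; apply: mud|apply: IH].
apply/funext => y; rewrite -kint_fiber // -(pfZ mup) -?(pfD mup).
- by congr kint; apply/funext => x; rewrite /seval big_cons.
- by apply/approxZ/(approx_fiber (h := \1_D))/approx_indic.
- exact/approx_fiber/approx_seval.
- exact/(approx_fiber (h := \1_D))/approx_indic.
Qed.

Lemma iterate_pf (J : finType) (Phi : (vec U J -> R) -> R) :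
  positive_functional Phi ->
  positive_functional (fun h : vec U (I + J) -> R =>
    Phi (fun y => kint mu (fun x => h (pairv x y)))).
Proof.
move=> pPhi; split.
- move=> f g af ag; rewrite -(pfD pPhi); [|exact: approx_kint..].
  by congr Phi; apply/funext => y; rewrite (pfD mup) //; apply: approx_fiber.
- move=> c f af; rewrite -(pfZ pPhi); last exact: approx_kint.
  by congr Phi; apply/funext => y; rewrite (pfZ mup) //; apply: approx_fiber.
- move=> f g af ag fg; apply: (pf_le pPhi); [exact: approx_kint..|move=> y].
  by apply: (pf_le mup) => //; apply: approx_fiber.
- by under eq_fun do rewrite (pf1 mup); rewrite (pf1 pPhi).
Qed.

End Iterate.

End Integration.

(** * Saturation *)

Section Smallness.

Lemma card_le_injP (T : Type) (S : pointedType) (A : set T) (B : set S) :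
  A #<= B <-> exists2 f : T -> S, set_fun A B f & set_inj A f.
Proof. by rewrite -injfunPex; split=> /pcard_leP. Qed.

Lemma infinite_injection (T : Type) : infinite_set [set: T] ->
  exists e : nat -> T, injective e.
Proof.
move=> /infiniteP /card_leP [f].
exists (fun n => val (f (SigSub (mem_set (I : [set: nat] n))))) => m n /val_inj.
by move=> /inj; rewrite !inE => /(_ I I) [].
Qed.

Variable kappa : Type.

Lemma small_sub (T : Type) (A B : set T) : A `<=` B -> small kappa B -> small kappa A.
Proof. by move=> AB sB sA; apply/sB/(card_le_trans sA)/subset_card_le. Qed.

Hypothesis kappa_inf : infinite_set [set: kappa].

Lemma small_adjoin1 (T : pointedType) (A : set T) (a : T) :
  small kappa A -> small kappa (a |` A).
Proof.
move=> sA /card_le_injP [g gA gi]; apply: sA; apply/card_le_injP.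
have {}gi k l : g k = g l -> k = l by move=> kl; apply: gi kl; rewrite inE.
have [[k0 k0a]|nk] := pselect (exists k, g k = a); last first.
  exists g => [k _|k l _ _ /gi //].
  by case: (gA k I) => // ka; case: nk; exists k.
have [e ei] := infinite_injection kappa_inf.
(* Hilbert's hotel: [s] is an injection missing [e 0], and [t] exchanges [e 0]
   and [k0]. *)
pose s k := if pselect (exists n, e n = k) is left H then e (projT1 (cid H)).+1 else k.
have sE n : s (e n) = e n.+1.
  rewrite /s; case: pselect => [H|[]]; last by exists n.
  by case: (cid H) => m /= /ei ->.
have sN k : ~ (exists n, e n = k) -> s k = k by rewrite /s; case: pselect.
pose t k := if pselect (k = e 0%N) is left _ then k0
            else if pselect (k = k0) is left _ then e 0%N else k.
have ti k l : t k = t l -> k = l.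
  by rewrite /t; repeat (case: pselect => ?); congruence.
have si k l : s k = s l -> k = l.
  have [[m <-]|nk] := pselect (exists n, e n = k);
  have [[n <-]|nl] := pselect (exists n, e n = l); rewrite ?sE ?(sN _ nk) ?(sN _ nl) //.
  - by move=> /ei [->].
  - by move=> H; case: nl; exists m.+1.
  - by move=> H; case: nk; exists n.+1.
have s0 k : s k <> e 0%N.
  have [[m <-]|nk] := pselect (exists n, e n = k); rewrite ?sE ?(sN _ nk).
    by move=> /ei.
  by move=> H; apply: nk; exists 0%N.
exists (g \o t \o s) => [k _|k l _ _ /gi /ti /si //] /=.
have [ka|//] := gA (t (s k)) I.
have : t (s k) = k0 by apply: gi; rewrite k0a.
rewrite /t; case: pselect => [/s0 //|_].
by case: pselect => // h1 h2; case: (s0 k); rewrite h2.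
Qed.

Lemma small_adjoin (T : pointedType) (K : finType) (A : set T) (c : K -> T) :
  small kappa A -> small kappa (A `|` range c).
Proof.
move=> sA.
suff H (r : seq K) : small kappa (A `|` [set c k | k in [set` r]]).
  apply: (small_sub _ (H (enum K))); apply: setUS => _ [k _ <-].
  by exists k => //=; rewrite mem_enum.
elim: r => [|k r IH]; first by apply: (small_sub _ sA) => x [//|[k]].
apply: (small_sub _ (small_adjoin1 (a := c k) IH)) => x [Ax|[l /= + <-]].
  by right; left.
by rewrite inE => /predU1P [->|lr]; [left|right; right; exists l].
Qed.

End Smallness.

Section Saturation.
Variables (kappa : Type) (R : realType) (L : language) (U : structure L).
Hypotheses (kappa_inf : infinite_set [set: kappa]) (Usat : saturated kappa U).

Lemma dsimple_params (J : Type) (s : simple R U J) : dsimple setT s ->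
  exists (K : finType) (c : K -> U), dsimple (range c) s.
Proof.
elim: s => [_|[r D] s IH] /=; first by exists void, (of_void _).
move=> [[J1 [phi [c1 [_ eD]]]] /IH [K [c ds]]].
exists (J1 + K)%type, (fun k => match k with inl j => c1 j | inr k => c k end).
split; last by apply: dsimple_mono ds => _ [k _ <-]; exists (inr k).
by exists J1, phi, c1; split=> // j; exists (inl j).
Qed.

(* Compactness; each list [Xs] below is a finite fragment of the partial type
   over [A] in the variables [(b, b')] saying that [b] and [b'] have the same
   type over [A]. *)
Lemma separating_formulas (A B : set U) (J : finType) (W : set (vec U (J + J))) :
  A `<=` B -> small kappa B -> definable B W ->
  (forall b b' : vec U J, same_type A b b' -> ~ W (pairv b b')) ->
  exists Xs : seq (set (vec U J)), (forall X, X \in Xs -> definable A X) /\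
    forall b b', (forall X, X \in Xs -> (X b <-> X b')) -> ~ W (pairv b b').
Proof.
move=> AB sB dW HW; pose eqX (X : set (vec U J)) := [set z | X (fstv z) <-> X (sndv z)].
pose p := [set E | E = W \/ exists2 X, definable A X & E = eqX X].
have pB : p `<=` definable B (I := (J + J)%type).
  move=> _ [->//|[X dX ->]].
  have d1 := definable_reindex (inl : J -> J + J) dX.
  have d2 := definable_reindex (inr : J -> J + J) dX.
  apply: definable_ext (definable_mono AB (definableU (definableI d1 d2)
    (definableI (definableC d1) (definableC d2)))) => z.
  rewrite /eqX /fstv /sndv /=; split=> [|H]; first by case=> -[].
  by have [h|h] := pselect (X (z \o inl)); [left|right]; split=> //; tauto.
have [fsp|] := pselect (finitely_satisfiable p).
  have [z Hz] := Usat sB pB fsp.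
  case: (HW (fstv z) (sndv z)); first by move=> D dD; apply: (Hz (eqX D)); right; exists D.
  rewrite (_ : pairv _ _ = z); first by apply: Hz; left.
  by apply/funext => -[].
move=> /existsNP [F /not_implyP [/finite_seqP [fs ->]]].
move=> /not_implyP [Fp F0].
suff [Xs [dXs HXs]] : exists Xs : seq (set (vec U J)),
    (forall X, X \in Xs -> definable A X) /\
    forall z, W z -> (forall X, X \in Xs -> eqX X z) -> forall E, E \in fs -> E z.
  exists Xs; split=> // b b' H Wb; apply: F0; exists (pairv b b') => E.
  by apply: HXs.
elim: fs Fp {F0} => [|E fs IH] Fp; first by exists [::].
have [D /= Dfs|Xs [dXs HXs]] := IH.
  by apply: Fp; rewrite /= inE Dfs orbT.
have [->|[X dX eE]] := Fp E (mem_head _ _).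
  exists Xs; split=> // z Wz Hz D; rewrite inE => /predU1P [-> //|].
  exact: HXs.
exists (X :: Xs); split=> [Y|z Wz Hz D].
  by rewrite inE => /predU1P [-> //|]; apply: dXs.
rewrite inE => /predU1P [->|].
  by rewrite eE; apply: Hz; rewrite mem_head.
by apply: HXs => // Y YXs; apply: Hz; rewrite inE YXs orbT.
Qed.

(** On each nonempty atom of the Boolean algebra generated by [Xs], the value of [h] at a chosen
    point serves as constant. Because [s] vanishes off [C], the functions found on the two halves of
    [C] can be added. *)
Lemma simple_of_atoms (A : set U) (J : Type) (h : vec U J -> R) e
    (Xs : seq (set (vec U J))) (C : set (vec U J)) :
  0 < e -> (forall X, X \in Xs -> definable A X) -> definable A C ->
  (forall b b', C b -> C b' -> (forall X, X \in Xs -> (X b <-> X b')) ->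
    `|h b - h b'| <= e) ->
  exists s, [/\ dsimple A s, forall x, C x -> `|h x - seval s x| <= e &
    forall x, ~ C x -> seval s x = 0].
Proof.
move=> e0; elim: Xs C => [|X Xs IH] C dXs dC H.
  have [C0|/set0P [b Cb]] := eqVneq C set0.
    exists [::]; split=> // x; first by rewrite C0.
    by rewrite /seval big_nil.
  exists [:: (h b, C)]; split=> // x Cx; rewrite /seval big_seq1 /= indicE.
    by rewrite mem_set // mulr1; apply: H.
  by rewrite memNset // mulr0.
have dX : definable A X by apply: dXs; rewrite mem_head.
have {}dXs Y : Y \in Xs -> definable A Y.
  by move=> YXs; apply: dXs; rewrite inE YXs orbT.
have [|b b' [Cb Xb] [Cb' Xb'] Hb|s [ds Hs s0]] := IH (C `&` X) dXs.
- exact: definableI.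
- by apply: H => // Y; rewrite inE => /predU1P [-> //|]; apply: Hb.
have [|b b' [Cb Xb] [Cb' Xb'] Hb|t [dt Ht t0]] := IH (C `&` ~` X) dXs.
- by apply: definableI => //; apply: definableC.
- by apply: H => // Y; rewrite inE => /predU1P [-> //|]; apply: Hb.
exists (s ++ t); split=> [|x Cx|x nCx]; first exact: dsimple_cat.
  rewrite seval_cat; have [Xx|nXx] := pselect (X x).
    by rewrite t0 ?addr0; [apply: Hs|case].
  by rewrite s0 ?add0r; [apply: Ht|case].
by rewrite seval_cat s0 ?t0 ?addr0 => // -[].
Qed.

(** Compactness removes the parameters outside [A]: points of equal type over [A] have close values,
    finitely many formulas over [A] already force this, and their atoms carry a simple function over
    [A]. *)
Lemma approx_invariant (A : set U) (J : finType) (h : vec U J -> R) :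
  small kappa A -> approx setT h ->
  (forall b b', same_type A b b' -> h b = h b') -> approx A h.
Proof.
move=> sA ah hA e e0; have e4 : 0 < e / 4 by rewrite divr_gt0.
have [s ds Hs] := ah _ e4.
have [K [c dsc]] := dsimple_params ds.
pose B := A `|` range c; have {}dsc : dsimple B s by apply: dsimple_mono dsc; right.
pose t := scomp (@fstv L U J J) s ++ sscale (-1) (scomp (@sndv L U J J) s).
have dt : dsimple B t.
  apply: dsimple_cat; first exact/dsimple_comp/dsc/definable_fun_fst.
  exact/dsimple_scale/dsimple_comp/dsc/definable_fun_snd.
have tE b b' : seval t (pairv b b') = seval s b - seval s b'.
  by rewrite seval_cat seval_scale !seval_comp mulN1r.
have [|b b' bb'|Xs [dXs HXs]] := @separating_formulas A B J _ _
    (small_adjoin kappa_inf sA) (definable_seval_gt (e / 2) dt).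
- by left.
- rewrite /= tE; have := hA _ _ bb'; have := Hs b; have := Hs b'.
  by rewrite !ler_norml => ? ? ?; apply/negP; lra.
have [||s' [ds' Hs' _]] := @simple_of_atoms A J h e Xs setT e0 dXs.
- exact: definableT.
(* [HXs] bounds the difference from one side only, hence both orders of the pair. The error is
   [e / 2] from the formulas and twice [e / 4] from the approximation. *)
- move=> b b' _ _ H; have := HXs b b' H; have := HXs b' b.
  rewrite /= !tE => /(_ (fun X XXs => iff_sym (H X XXs))) /negP + /negP.
  have := Hs b; have := Hs b'.
  rewrite -!leNgt !ler_norml => ? ? ? ?; lra.
by exists s' => // x; apply: Hs'.
Qed.

Lemma type_realized (A : set U) (J : finType) (q : types A J) :
  small kappa A -> exists b, realizes b q.
Proof.
move=> sA; case: (typeP q) => qd qf _.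
by have [b Hb] := Usat sA qd qf; exists b.
Qed.

Lemma realizesE (A : set U) (J : Type) (q : types A J) b D :
  realizes b q -> definable A D -> (q D <-> D b).
Proof.
move=> bq dD; split=> [/bq //|Db].
by case: (typeP q) => _ _ /(_ D dD) [//|/bq].
Qed.

End Saturation.

(** * Type spaces and regular extensions *)

Section TypeSpace.
Variables (L : language) (U : structure L) (A : set U) (J : finType).

Definition basic (D : set (vec U J)) : set (types A J) := [set q | q D].

Lemma basic_tp D (x : vec U J) : definable A D -> basic D (tp A x) <-> D x.
Proof. by move=> dD; split=> [[]|]. Qed.

Lemma typeI (q : types A J) (D E : set (vec U J)) : definable A D -> definable A E ->
  q (D `&` E) <-> q D /\ q E.
Proof.
move=> dD dE; case: (typeP q) => _ qf qc.
have dDE := definableI dD dE.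
have disj X Y : q X -> q Y -> X `&` Y !=set0.
  move=> qX qY; have [||x Hx] := qf [set X; Y].
  - by rewrite -[[set X; Y]]/([set X] `|` [set Y]) finite_setU; split; apply: finite_set1.
  - by move=> Z [->|->].
  - by exists x; split; apply: Hx; [left|right].
split=> [qDE|[qD qE]].
  split; [have [//|qn] := qc D dD|have [//|qn] := qc E dE];
    by have [x [[]]] := disj _ _ qDE qn.
have [//|qn] := qc _ dDE.
have [x Hx] : D `&` E `&` ~` (D `&` E) !=set0; last by case: Hx.
have [||x Hx] := qf ([set D] `|` [set E] `|` [set ~` (D `&` E)]).
- by rewrite !finite_setU; split; [split|]; apply: finite_set1.
- by move=> Z [[->|->]|->].
- by exists x; split; [split|]; apply: Hx; [left; left|left; right|right].
Qed.

Lemma typeT (q : types A J) : q setT.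
Proof.
case: (typeP q) => _ qf /(_ _ (definableT A J)) [//|]; rewrite setCT => q0.
have [||x Hx] := qf [set set0]; first exact: finite_set1.
  by move=> Z ->.
by have := Hx set0 erefl.
Qed.

Lemma typeC (q : types A J) D : definable A D -> q (~` D) <-> ~ q D.
Proof.
move=> dD; split=> [qC qD|nq].
  have [_ qf _] := typeP q; have [||x Hx] := qf ([set D] `|` [set ~` D]).
  - by rewrite finite_setU; split; apply: finite_set1.
  - by move=> Z [->|->].
  - by apply: (Hx (~` D)); [right|apply: Hx; left].
by have [_ _ /(_ _ dD) []] := typeP q.
Qed.

Lemma typeU (q : types A J) (D E : set (vec U J)) : definable A D -> definable A E ->
  q (D `|` E) -> q D \/ q E.
Proof.
move=> dD dE qU; have [qD|nqD] := pselect (q D); first by left.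
right; apply: contrapT => nqE; have := iffLR (typeC q (definableU dD dE)).
rewrite setCU typeI; [|exact: definableC..].
by apply; rewrite ?typeC.
Qed.

Lemma open_basic D : definable A D -> open (basic D).
Proof.
move=> dD; exists [set basic D]; last by rewrite bigcup_set1.
move=> _ ->; exists [fset D]%fset; first by move=> X; rewrite in_fset1 => /eqP ->; apply: mem_set.
by apply/seteqP; split=> q /= H; [by apply: H; rewrite /= inE|by move=> X; rewrite /= inE => /eqP ->].
Qed.

(** The topology is generated by a sub-base; since types respect finite intersections, the sub-base
    is already a base. *)
Lemma open_nbhs_basic (O : set (types A J)) q : open O -> O q ->
  exists D, [/\ definable A D, q D & basic D `<=` O].
Proof.
move=> [F FI <-] [B FB Bq]; have [S SD eB] := FI _ FB.
suff [D [dD eD]] : exists D, definable A D /\ basic D = B.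
  exists D; split=> //; first by have : basic D q by rewrite eD.
  by rewrite eD => r Br; exists B.
rewrite -eB; have {}SD : forall X, X \in enum_fset S -> definable A X.
  by move=> X XS; apply: set_mem; apply: SD.
rewrite (_ : \bigcap_(_ in _) _ = [set r : types A J | forall X, X \in enum_fset S -> r X]) //.
elim: (enum_fset S) SD => [|X s IH] dS.
  exists setT; split; first exact: definableT.
  by apply/seteqP; split=> r //= _; apply: typeT.
have [Y Ys|D [dD eD]] := IH; first by apply: dS; rewrite inE Ys orbT.
have dX : definable A X by apply: dS; rewrite mem_head.
exists (X `&` D); split; first exact: definableI.
apply/seteqP; split=> r /=; rewrite /basic /= typeI //.
  move=> [rX rD] Y; rewrite inE => /predU1P [-> //|Ys].
  by have : basic D r by []; rewrite eD; apply.
move=> H; split; first by apply: H; rewrite mem_head.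
by have : basic D r; [rewrite eD => Y Ys; apply: H; rewrite inE Ys orbT|].
Qed.

Lemma basicC D : definable A D -> ~` basic D = basic (~` D).
Proof. by move=> dD; apply/seteqP; split=> q /=; rewrite /basic /= typeC. Qed.

Lemma basic_sub D E : definable A D -> definable A E ->
  basic D `<=` basic E -> D `<=` E.
Proof. by move=> dD dE DE x /(basic_tp _ dD) /DE /(basic_tp _ dE). Qed.

End TypeSpace.
Arguments basic {L U} A J D.

Section RegularExtension.
Variables (kappa : Type) (R : realType) (L : language) (U : structure L).
Variables (A : set U) (J : finType) (nu : set (vec U J) -> R).
Hypotheses (Usat : saturated kappa U) (A_small : small kappa A).
Hypothesis nuK : is_keisler nu.

Local Notation X := (types A J).
Local Notation Bs := (@basic _ _ A J).

Definition inner_content (O : set X) : R :=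
  sup [set r | exists D, [/\ definable A D, (Bs D) `<=` O & r = nu D]].

Definition outer_content (E : set X) : R :=
  inf [set r | exists O, [/\ open O, E `<=` O & r = inner_content O]].

Let dT D : @definable L U A J D -> definable setT D.
Proof. exact: definable_mono. Qed.

Lemma inner_content_ge D O : definable A D -> (Bs D) `<=` O -> nu D <= inner_content O.
Proof.
move=> dD DO; apply: ub_le_sup; last by exists D.
by exists 1 => _ [E [dE _ ->]]; apply/(keisler_le1 nuK)/dT.
Qed.

Lemma basic0 : Bs set0 = set0.
Proof.
apply/seteqP; split=> q //= q0; have := typeC q (definableT A J).
by rewrite setCT => -[/(_ q0) []]; apply: typeT.
Qed.

Lemma inner_content_le O c :
  (forall D, definable A D -> (Bs D) `<=` O -> nu D <= c) -> inner_content O <= c.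
Proof.
move=> H; apply: ge_sup => [|_ [D [dD DO ->]]]; last exact: H.
exists (nu set0), set0; split=> //; first exact: definable0.
by rewrite basic0.
Qed.

Lemma inner_content_ge0 O : 0 <= inner_content O.
Proof.
rewrite -(keisler0 nuK); apply: inner_content_ge; first exact: definable0.
by rewrite basic0.
Qed.

Lemma inner_content_mono O O' : O `<=` O' -> inner_content O <= inner_content O'.
Proof.
move=> OO'; apply: inner_content_le => D dD DO.
by apply: inner_content_ge => //; apply: subset_trans DO OO'.
Qed.

Lemma outer_content_le E O : open O -> E `<=` O -> outer_content E <= inner_content O.
Proof.
move=> oO EO; apply: ge_inf; last by exists O.
by exists 0 => _ [V [_ _ ->]]; apply: inner_content_ge0.
Qed.

Lemma outer_content_ge E c :
  (forall O, open O -> E `<=` O -> c <= inner_content O) -> c <= outer_content E.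
Proof.
move=> H; apply: lb_le_inf => [|_ [V [oV EV ->]]]; last exact: H.
by exists (inner_content setT), setT; split=> //; apply: openT.
Qed.

Lemma outer_content_open O : open O -> outer_content O = inner_content O.
Proof.
move=> oO; apply/eqP; rewrite eq_le outer_content_le //=.
by apply: outer_content_ge => O' _; apply: inner_content_mono.
Qed.

Lemma outer_content_basic D : definable A D -> outer_content (Bs D) = nu D.
Proof.
move=> dD; rewrite outer_content_open; last exact: open_basic.
apply/eqP; rewrite eq_le inner_content_ge // andbT.
apply: inner_content_le => E dE ED; apply: (keisler_le nuK); [exact: dT..|].
exact: basic_sub ED.
Qed.

Lemma outer_content0 : outer_content set0 = 0.
Proof. by rewrite -basic0 outer_content_basic ?(keisler0 nuK) //; apply: definable0. Qed.

Lemma outer_content_ge0 E : 0 <= outer_content E.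
Proof. by apply: outer_content_ge => O _ _; apply: inner_content_ge0. Qed.

Lemma outer_content_mono E E' : E `<=` E' -> outer_content E <= outer_content E'.
Proof.
move=> EE'; apply: outer_content_ge => O oO E'O.
by apply: outer_content_le => //; apply: subset_trans EE' E'O.
Qed.

(** Compactness from saturation: a point of [D] outside every clopen subset of every [O n] would
    have its type in no [O n]. One formula is kept for each [O n], so that subadditivity can be
    checked term by term. *)
Lemma basic_compact (D : set (vec U J)) (O : nat -> set X) : definable A D ->
  (forall n, open (O n)) -> (Bs D) `<=` \bigcup_n O n ->
  exists (E : nat -> set (vec U J)) N,
    (forall n, definable A (E n) /\ (Bs (E n)) `<=` O n) /\
    forall x, D x -> exists2 n, (n < N)%N & E n x.
Proof.
move=> dD oO DO.
pose p := [set F | F = D \/ exists E, [/\ definable A E, exists n, (Bs E) `<=` O n & F = ~` E]].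
have pA : p `<=` definable A (I := J).
  by move=> _ [->//|[E [dE _ ->]]]; apply: definableC.
have [fsp|] := pselect (finitely_satisfiable p).
  have [b Hb] := Usat A_small pA fsp.
  have [n _ On] : (\bigcup_n O n) (tp A b).
    by apply: DO; split=> //; apply: Hb; left.
  have [E [dE Eb EO]] := open_nbhs_basic (oO n) On.
  have : (~` E) b by apply: Hb; right; exists E; split=> //; exists n.
  by case; case: Eb.
move=> /existsNP [F /not_implyP [/finite_seqP [fs ->]]].
move=> /not_implyP [Fp F0].
suff [E [N [HE HN]]] : exists (E : nat -> set (vec U J)) N,
    (forall n, definable A (E n) /\ (Bs (E n)) `<=` O n) /\
    forall x, D x -> (exists2 n, (n < N)%N & E n x) \/ forall G, G \in fs -> G x.
  exists E, N; split=> // x /HN [//|H]; case: F0; exists x => G Gfs.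
  exact: H.
elim: fs Fp {F0} => [|K fs IH] Fp.
  exists (fun=> set0), 0%N; split=> [n|x _]; last by right.
  by rewrite basic0; split=> //; apply: definable0.
have [G /= Gfs|E [N [HE HN]]] := IH.
  by apply: Fp; rewrite /= inE Gfs orbT.
have [->|[E' [dE' [m E'O] ->]]] := Fp K (mem_head _ _).
  exists E, N; split=> // x Dx; have [?|H] := HN x Dx; [by left|right=> G].
  by rewrite inE => /predU1P [-> //|]; apply: H.
(* A further formula found inside [O m] is joined to the one already there. *)
exists (fun n => if n == m then E n `|` E' else E n), (maxn N m.+1); split=> [n|x Dx].
  case: eqVneq => [->|_]; last exact: HE.
  have [dE EO] := HE m; split; first exact: definableU.
  by move=> q /typeU [//|//|/EO|/E'O].
have [[n nN En]|H] := HN x Dx.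
  left; exists n; first by rewrite leq_max nN.
  by case: eqVneq => // _; left.
have [E'x|nE'x] := pselect (E' x).
  left; exists m; first by rewrite leq_max ltnSn orbT.
  by rewrite eqxx; right.
by right=> G; rewrite inE => /predU1P [-> //|]; apply: H.
Qed.

Lemma basic_subadditive (D : set (vec U J)) (O : nat -> set X) : definable A D ->
  (forall n, open (O n)) -> (Bs D) `<=` \bigcup_n O n ->
  exists N, nu D <= \sum_(n < N) inner_content (O n).
Proof.
move=> dD oO DO; have [E [N [HE HN]]] := basic_compact dD oO DO.
exists N; elim: N D dD HN {DO} => [|N IH] D dD HN.
  rewrite big_ord0 (_ : D = set0) ?(keisler0 nuK) //.
  by apply/seteqP; split=> x // /HN [].
have [dE EO] := HE N.
rewrite big_ord_recr /= (keisler_split nuK (dT dD) (dT dE)) [leLHS]addrC.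
apply: lerD.
  apply: IH => [|x [Dx nEx]]; first by apply: definableI => //; apply: definableC.
  have [n + En] := HN x Dx; rewrite ltnS leq_eqVlt => /predU1P [nN|nN].
    by case: nEx; rewrite -nN.
  by exists n.
apply: le_trans (inner_content_ge dE EO).
by apply: (keisler_le nuK); [exact/dT/definableI|exact: dT|exact: subIsetr].
Qed.

Let om (E : set X) : \bar R := (outer_content E)%:E.

Lemma outer_content_sigma_subadditive : sigma_subadditive om.
Proof.
move=> F; apply/lee_addgt0Pr => e e0.
have e2 n : 0 < e / (2 ^ n.+1)%:R by rewrite divr_gt0 // ltr0n expn_gt0.
have HO n : exists O, [/\ open O, F n `<=` O &
    inner_content O <= outer_content (F n) + e / (2 ^ n.+1)%:R].
  apply: contrapT => H.
  have : outer_content (F n) + e / (2 ^ n.+1)%:R <= outer_content (F n).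
    apply: outer_content_ge => O oO FO; rewrite leNgt; apply/negP => lt.
    by apply: H; exists O; split=> //; apply: ltW.
  by rewrite gerDl leNgt e2.
have [ O HO'] := choice HO.
have oO n : open (O n) by case: (HO' n).
apply: le_trans (epsilon_trick xpredT _ (ltW e0)); last first.
  by move=> n; rewrite lee_fin outer_content_ge0.
have UO : \bigcup_n F n `<=` \bigcup_n O n.
  by move=> q [n _ Fq]; exists n => //; case: (HO' n) => _ + _; apply.
have ge0 n : (0 <= om (F n) + (e / (2 ^ n.+1)%:R)%:E)%E.
  by rewrite -EFinD lee_fin addr_ge0 ?outer_content_ge0 // ltW.
apply: (@le_trans _ _ (inner_content (\bigcup_n O n))%:E).
  by rewrite lee_fin; apply: outer_content_le => //; apply: bigcup_open.
have H D : definable A D -> (Bs D) `<=` \bigcup_n O n ->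
    ((nu D)%:E <= \sum_(i <oo) (om (F i) + (e / (2 ^ i.+1)%:R)%:E))%E.
  move=> dD DO; have [N HN] := basic_subadditive dD oO DO.
  apply: le_trans (nneseries_lim_ge N _); last by move=> *; apply: ge0.
  rewrite big_mkord; under eq_bigr do rewrite -EFinD.
  rewrite sumEFin lee_fin (le_trans HN) //; apply: ler_sum => i _.
  by case: (HO' i).
move: H; set s := (\sum_(i <oo) _)%E; case: s => [s|//|] H.
- by rewrite lee_fin; apply: inner_content_le => D dD DO; rewrite -lee_fin H.
- by rewrite leey.
(* The empty set gives a finite lower bound, which excludes a sum equal to minus infinity. *)
- have := H set0 (definable0 _ _); rewrite basic0 => /(_ (@sub0set _ _)).
  by rewrite leNgt ltNyr.
Qed.

(** The nontrivial half of Carathéodory measurability of open sets. Inside an open [V] containing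
    [E], fill [V] intersected with [O] by a clopen [D]; the rest of [V] is then open, still covers
    [E] outside [O], and is filled by a clopen [F] disjoint from [D]. *)
Lemma outer_content_split (O E : set X) : open O ->
  outer_content (E `&` O) + outer_content (E `&` ~` O) <= outer_content E.
Proof.
move=> oO; apply: outer_content_ge => V oV EV.
have h1 : outer_content (E `&` O) <= inner_content (V `&` O).
  by apply: outer_content_le; [apply: openI|apply: setSI].
suff h2 : inner_content (V `&` O) <= inner_content V - outer_content (E `&` ~` O).
  lra.
apply: inner_content_le => D dD DVO.
have h3 : outer_content (E `&` ~` O) <= inner_content (V `&` (Bs (~` D))).
  apply: outer_content_le; first by apply: openI => //; apply/open_basic/definableC.
  move=> q [Eq nOq]; split; first exact: EV.
  by rewrite -basicC // => /DVO [].
suff h4 : inner_content (V `&` (Bs (~` D))) <= inner_content V - nu D by lra.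
apply: inner_content_le => F dF FV.
have DF : D `&` F = set0.
  apply/seteqP; split=> x // [Dx Fx].
  have /FV [_] : (Bs F) (tp A x) by split.
  by case.
have dDF := definableU dD dF.
have : nu (D `|` F) <= inner_content V.
  by apply: inner_content_ge => // q /typeU [//|//|/DVO []|/FV []].
case: nuK => _ _ /(_ D F (dT dD) (dT dF) DF) ->; lra.
Qed.

Theorem regular_extension_exists :
  exists P : probability (borel_types A J) R, regular_extension nu P.
Proof.
have om0 : om set0 = 0%E by rewrite /om outer_content0.
have om_ge0 E : (0 <= om E)%E by rewrite lee_fin outer_content_ge0.
have om_le : {homo om : E E' / E `<=` E' >-> (E <= E')%E}.
  by move=> E E' EE'; rewrite lee_fin outer_content_mono.
pose m : {outer_measure set X -> \bar R} := HB.pack om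
  (isOuterMeasure.Build R X om om0 om_ge0 om_le outer_content_sigma_subadditive).
have cara_sigma : sigma_algebra setT m.-caratheodory.
  split; first exact: caratheodory_measurable_set0.
    by move=> E mE; rewrite setTD; apply: caratheodory_measurable_setC.
  exact: caratheodory_measurable_bigcup.
have borel_cara (B : set (borel_types A J)) : measurable B -> m.-caratheodory B.
  move: B; apply: smallest_sub => // O oO; apply: le_caratheodory_measurable => E.
  by rewrite lee_fin outer_content_split.
pose P0 : set (borel_types A J) -> \bar R := om.
have P_sigma : semi_sigma_additive P0.
  move=> F mF tF mUF; apply: (@caratheodory_measure_sigma_additive R X m F) => //.
    by move=> i; apply: borel_cara.
  exact: borel_cara.
have P_T : P0 setT = 1%E.
  have := outer_content_basic (definableT A J).
  rewrite (_ : Bs setT = setT); last by apply/seteqP; split=> q // _; apply: typeT.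
  by rewrite /P0 /om => ->; case: nuK => _ ->.
pose P1 : {measure set (borel_types A J) -> \bar R} :=
  HB.pack P0 (isMeasure.Build _ _ _ P0 om0 om_ge0 P_sigma).
pose P : probability (borel_types A J) R :=
  HB.pack P0 (Measure.class P1) (Measure_isProbability.Build _ _ _ P1 P_T).
exists P; split=> [D dD|B mB].
  by rewrite -(outer_content_basic dD).
apply/eqP; rewrite eq_le; apply/andP; split; last first.
  by apply: ge_ereal_sup => _ [C [_ CB] <-]; rewrite lee_fin outer_content_mono.
apply/lee_addgt0Pr => e e0.
(* Approximating [B] from inside by closed sets amounts to approximating its complement from outside
   by open sets. *)
have [V [oV BV HV]] : exists V, [/\ open V, ~` B `<=` V &
    inner_content V <= outer_content (~` B) + e].
  apply: contrapT => H.
  have : outer_content (~` B) + e <= outer_content (~` B).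
    apply: outer_content_ge => V oV BV; rewrite leNgt; apply/negP => lt.
    by apply: H; exists V; split=> //; apply: ltW.
  by rewrite gerDl leNgt e0.
have mV : measurable (V : set (borel_types A J)) by apply: sub_sigma_algebra.
have PVC : P (~` V) = (1 - inner_content V)%:E.
  by rewrite probability_setC // EFinB -(outer_content_open oV).
have PB : P B = (1 - outer_content (~` B))%:E.
  rewrite -[in LHS](setCK B) probability_setC ?EFinB //; exact: measurableC.
apply: (@le_trans _ _ (P (~` V) + e%:E)%E).
  by rewrite PB PVC -EFinD lee_fin; lra.
rewrite leeD2r //; apply: ereal_sup_ubound; exists (~` V) => //.
by split; [apply: open_closedC|rewrite -[X in _ `<=` X](setCK B); apply: subsetC].
Qed.

End RegularExtension.

(** * Morley products *)

Section Morley.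
Variables (kappa : Type) (R : realType) (L : language) (U : structure L).
Hypotheses (kappa_inf : infinite_set [set: kappa]) (Usat : saturated kappa U).
Variables (I : finType) (mu : set (vec U I) -> R).
Hypotheses (muK : is_keisler mu) (mud : definable_measure mu).

Lemma type_invariantW (A B : set U) : A `<=` B -> type_invariant A mu -> type_invariant B mu.
Proof.
move=> AB iA J D dD b b' bb'; apply: (iA _ _ dD) => E dE.
exact/bb'/(definable_mono AB).
Qed.

(** The parameters of [D] are appended to [b]; as they lie in [A], this preserves equality of types
    over [A]. *)
Lemma fiber_invariant (A : set U) (J : finType) (D : set (vec U (I + J))) b b' :
  type_invariant A mu -> definable A D -> same_type A b b' ->
  mu (fiber D b) = mu (fiber D b').
Proof.
move=> iA /definable_set0_fiber [K [E [c [dE Ac ->]]]] bb'.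
pose r (k : I + J + K) : I + (J + K) := match k with
  | inl (inl i) => inl i | inl (inr j) => inr (inl j) | inr k => inr (inr k) end.
have eE d : fiber (fiber E c) d = fiber [set z : vec U (I + (J + K)) | E (z \o r)] (pairv d c).
  apply/seteqP; split=> x; rewrite /fiber /=; congr (E _);
    by apply/funext => -[[]|].
rewrite !eE; apply: iA; first exact: definable_reindex.
move=> F dF.
have := bb' [set d | F (pairv d c)]; apply.
pose s (k : J + K) : K + J := match k with inl j => inr j | inr k => inl k end.
have := definable_param Ac (definable_reindex s dF).
apply: definable_ext => x /=; rewrite (_ : pairv c x \o s = pairv x c) //.
by apply/funext => -[].
Qed.

Section Over.
Variables (A : set U) (J : finType) (D : set (vec U (I + J))).
Hypotheses (sA : small kappa A) (iA : type_invariant A mu) (dD : definable A D).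

Let dDT : definable setT D. Proof. exact: definable_mono dD. Qed.

Lemma approx_fiber_over : approx A (fun b => mu (fiber D b)).
Proof.
apply: (approx_invariant kappa_inf Usat) => //; first exact: mud.
by move=> b b'; apply: fiber_invariant.
Qed.

Lemma Fmap_realizes (q : borel_types A J) b :
  realizes b (q : types A J) -> Fmap mu D q = mu (fiber D b).
Proof.
move=> bq; rewrite /Fmap; case: xgetP => [b' _ b'q|]; last first.
  by move/(_ b).
apply: (fiber_invariant iA dD) => E dE.
by rewrite -(realizesE bq dE) -(realizesE b'q dE).
Qed.

(** [Fmap] is lower semicontinuous: its strict superlevel sets are unions of clopen sets. *)
Lemma measurable_Fmap : measurable_fun [set: borel_types A J] (Fmap mu D).
Proof.
apply: (measurability _ (RGenOInfty.measurableE R)) => _ [_ [r ->] <-].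
apply: sub_sigma_algebra; rewrite setTI.
rewrite (_ : _ @^-1` _ = \bigcup_(E in [set E | definable A E /\
    basic A J E `<=` [set q | r < Fmap mu D q]]) basic A J E).
  by apply: bigcup_open => E [dE _]; apply: open_basic.
apply/seteqP; split=> q /=; rewrite in_itv /= andbT; last first.
  by move=> [E [_ /(_ q)]].
move=> rF; have [b bq] := type_realized Usat q sA.
(* The error is a quarter of the gap and [t] is its midpoint, so [q] passes the test and every type
   that passes it has value above [r]. *)
have e0 : 0 < (Fmap mu D q - r) / 4 by rewrite divr_gt0 // subr_gt0.
have [s ds Hs] := approx_fiber_over e0.
pose t := r + (Fmap mu D q - r) / 2.
have dE := definable_seval_gt t ds.
exists [set x | t < seval s x]; [split=> // q' qE|].
  have [b' bq'] := type_realized Usat q' sA.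
  have /= := iffLR (realizesE bq' dE) qE.
  rewrite (Fmap_realizes bq'); have := Hs b'; rewrite ler_norml /t; lra.
rewrite /basic /= (realizesE bq dE) /= /t.
have := Hs b; rewrite -(Fmap_realizes bq) ler_norml; lra.
Qed.

Lemma Fmap01 (q : borel_types A J) : 0 <= Fmap mu D q <= 1.
Proof.
have [b bq] := type_realized Usat (q : types A J) sA.
have dDb : definable setT (fiber D b) by apply: definable_fiber.
by rewrite (Fmap_realizes bq) keisler_le1 // andbT; case: muK => + _ _; apply.
Qed.

Variables (nu : set (vec U J) -> R) (P : probability (borel_types A J) R).
Hypotheses (nuK : is_keisler nu) (nuP : regular_extension nu P).

Let lift (s : simple R U J) (q : borel_types A J) : R :=
  \sum_(p <- s) p.1 * \1_(basic A J p.2) q.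

Let measurable_basic E : definable A E -> measurable (basic A J E : set (borel_types A J)).
Proof. by move=> dE; apply: sub_sigma_algebra; apply: open_basic. Qed.

Let lift_integral s : dsimple A s ->
  P.-integrable setT (EFin \o lift s) /\ Rintegral P setT (lift s) = smass nu s.
Proof.
elim: s => [_|[c E] s IH] /=.
  rewrite /smass big_nil (_ : lift [::] = cst 0).
    split; last by rewrite Rintegral_cst // mul0r.
    exact: finite_measure_integrable_cst.
  by apply/funext => q; rewrite /lift big_nil.
move=> [dE /IH [is_ es]].
have iE : P.-integrable setT (EFin \o \1_(basic A J E)).
  exact: (integrable_indic P (measurable_basic dE)).
have iE' : P.-integrable setT (EFin \o (fun q => c * \1_(basic A J E) q)).
  exact: (integrableZl measurableT c iE).
have -> : lift ((c, E) :: s) = fun q => c * \1_(basic A J E) q + lift s q.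
  by apply/funext => q; rewrite /lift big_cons.
split; first exact: (integrableD measurableT iE' is_).
rewrite RintegralD // RintegralZl // es /smass big_cons /=; congr (_ * _ + _).
rewrite /Rintegral integral_indic //; last exact: measurable_basic.
by rewrite setIT; case: nuP => /(_ E dE) H _; rewrite [X in fine X]H.
Qed.

(** The bridge between Lebesgue and finitely additive integration: both sides are within [e / 2] of
    the mass of one simple function, whose clopen sets have the same measure under [P] and [nu]. *)
Lemma Rintegral_Fmap :
  Rintegral P setT (Fmap mu D) = kint nu (fun b => mu (fiber D b)).
Proof.
apply: eq_small => e e0; have e2 : 0 < e / 2 by rewrite divr_gt0.
have [s ds Hs] := approx_fiber_over e2.
have [is_ es] := lift_integral ds.
have iF : P.-integrable setT (EFin \o Fmap mu D).
  apply: measurable_bounded_integrable => //.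
  - by rewrite -ge0_fin_numE //; apply: fin_num_measure.
  - exact: measurable_Fmap.
  - exists 1; split=> // M M1 q _ /=.
    have /andP [? ?] := Fmap01 q; rewrite ger0_norm //; lra.
have H q : `|Fmap mu D q - lift s q| <= e / 2.
  have [b bq] := type_realized Usat (q : types A J) sA.
  rewrite (Fmap_realizes bq) (_ : lift s q = seval s b) //.
  rewrite /lift /seval; elim: s ds {Hs is_ es} => [|[c E] s IH] /= => [_|[dE ds]].
    by rewrite !big_nil.
  rewrite !big_cons IH //= !indicE; congr (_ * _%:R + _); congr (nat_of_bool _).
  have := realizesE bq dE.
  by apply: asbool_equiv_eq.
have ie c : P.-integrable setT (EFin \o (fun q : borel_types A J => lift s q + c)).
  apply: (integrableD measurableT is_ (finite_measure_integrable_cst P c measurableT)).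
have Ic c : Rintegral P setT (fun q => lift s q + c) = smass nu s + c.
  rewrite RintegralD // ?es //; last exact: finite_measure_integrable_cst.
  by rewrite Rintegral_cst // [X in fine X](probability_setT P) mulr1.
have h1 : Rintegral P setT (Fmap mu D) <= smass nu s + e / 2.
  rewrite -Ic; apply: (le_Rintegral measurableT iF (ie _)) => q _.
  by have := H q; rewrite ler_norml; lra.
have h2 : smass nu s - e / 2 <= Rintegral P setT (Fmap mu D).
  rewrite -Ic; apply: (le_Rintegral measurableT (ie _) iF) => q _.
  by have := H q; rewrite ler_norml; lra.
have dsT : dsimple setT s by apply: dsimple_mono ds.
have := kint_close nuK dsT Hs; rewrite !ler_norml; lra.
Qed.

End Over.

Variable A0 : set U.
Hypotheses (sA0 : small kappa A0) (iA0 : type_invariant A0 mu).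

(** Every admissible [A] and [P] give the same integral, so the choice made by [xget] is harmless.
    The default 0 does not occur: adjoining the parameters of [D] to [A0] produces an admissible
    set, and a regular extension exists. *)
Lemma morleyE (J : finType) (nu : set (vec U J) -> R) (D : set (vec U (I + J))) :
  is_keisler nu -> definable setT D ->
  morley kappa mu nu D = kint nu (fun b => mu (fiber D b)).
Proof.
move=> nuK dD; rewrite /morley; case: xgetP => [r _|].
  move=> [A [sA [iA _] dDA [P nuP ->]]].
  exact: Rintegral_Fmap.
have [K [E [c [dE _ eD]]]] := definable_set0_fiber dD.
pose A := A0 `|` range c.
have sA : small kappa A by apply: small_adjoin.
have iA : type_invariant A mu by apply: type_invariantW iA0 => x; left.
have dA F : definable set0 F -> @definable L U A _ F by apply: definable_mono.
have dDA : definable A D.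
  rewrite eD; apply: definable_fiber; last exact: definable_mono dE.
  by move=> k; right; exists k.
have [P nuP] := @regular_extension_exists _ R L U A J nu Usat sA nuK.
move=> /(_ (kint nu (fun b => mu (fiber D b)))) [].
exists A; split=> //.
  by split=> // J' F dF; apply: measurable_Fmap => //; apply: definable_mono dF.
by exists P => //; rewrite (Rintegral_Fmap sA iA dDA nuK nuP).
Qed.

End Morley.

(** * Averages over finite samples *)

Section Averages.
Variable R : realType.

Definition avg (T : Type) (s : seq T) (f : T -> R) : R := (\sum_(a <- s) f a) / (size s)%:R.

Lemma avg_close (T : Type) (s : seq T) f g e : 0 <= e -> (forall a, `|f a - g a| <= e) ->
  `|avg s f - avg s g| <= e.
Proof.
move=> e0 H; rewrite /avg -mulrBl -sumrB normrM [X in _ * X <= _]ger0_norm ?invr_ge0 //.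
(* The inverse of 0 being 0, an empty sample has average 0. *)
have [s0|s0] := eqVneq (size s) 0%N; first by rewrite s0 invr0 mulr0.
have s0' : 0 < (size s)%:R :> R by rewrite ltr0n lt0n.
rewrite ler_pdivrMr // (le_trans (ler_norm_sum _ _ _)) //.
have -> : e * (size s)%:R = \sum_(a <- s) e by rewrite big_const_seq count_predT iter_addr_0 mulr_natr.
by apply: ler_sum.
Qed.

Lemma avg01 (T : Type) (s : seq T) f : (forall a, 0 <= f a <= 1) -> 0 <= avg s f <= 1.
Proof.
move=> H; apply/andP; split.
  by rewrite mulr_ge0 ?invr_ge0 // sumr_ge0 // => a _; case/andP: (H a).
rewrite /avg; have [s0|s0] := eqVneq (size s) 0%N.
  by rewrite s0 invr0 mulr0 ler01.
rewrite ler_pdivrMr ?ltr0n ?lt0n // mul1r.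
have -> : (size s)%:R = \sum_(a <- s) 1 :> R.
  by rewrite big_const_seq count_predT iter_addr_0.
by apply: ler_sum => a _; case/andP: (H a).
Qed.

Lemma exchange_avg (T S : Type) (s : seq T) (t : seq S) (f : T -> S -> R) :
  avg s (fun x => avg t (f x)) = avg t (fun y => avg s (f^~ y)).
Proof.
rewrite /avg -mulr_suml -mulr_suml exchange_big /= -!mulrA; congr (_ * _).
exact: mulrC.
Qed.

End Averages.

(** * Integration against Morley products and powers *)

Section MorleyMeasures.
Variables (kappa : Type) (R : realType) (L : language) (U : structure L).
Hypotheses (kappa_inf : infinite_set [set: kappa]) (Usat : saturated kappa U).

Lemma pf_comp (J K : finType) (Phi : (vec U J -> R) -> R) (f : vec U J -> vec U K) :
  positive_functional Phi -> definable_fun setT f ->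
  positive_functional (fun h => Phi (fun x => h (f x))).
Proof.
move=> pPhi df; split.
- by move=> g h ag ah; rewrite (pfD pPhi) //; apply: approx_comp.
- by move=> c g ag; rewrite (pfZ pPhi) //; apply: approx_comp.
- by move=> g h ag ah gh; apply: (pf_le pPhi) => //; apply: approx_comp.
- exact: pf1 pPhi.
Qed.

Lemma pf_keisler (J : Type) (Phi : (vec U J -> R) -> R) :
  positive_functional Phi -> is_keisler (fun D => Phi (\1_D)).
Proof.
move=> pPhi; split.
- move=> D dD; rewrite -(pf_cst pPhi 0); apply: (pf_le pPhi) => //.
    exact: approx_cst.
  exact: approx_indic.
- by rewrite indicT (pf1 pPhi).
- move=> D E dD dE DE; rewrite -(pfD pPhi); [|exact: approx_indic..].
  congr Phi; apply/funext => x; rewrite !indicE -natrD in_setU.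
  have [xD|//] := boolP (x \in D).
  have -> // : x \in E = false.
  by apply/negP => xE; have : set0 x by rewrite -DE; split; apply: set_mem.
Qed.

Variables (I : finType) (mu : set (vec U I) -> R).
Hypotheses (muK : is_keisler mu) (mud : definable_measure mu).
Variable A0 : set U.
Hypotheses (sA0 : small kappa A0) (iA0 : type_invariant A0 mu).

Lemma approx_kint_curry (J : finType) (F : vec U I -> vec U J -> R) :
  approx setT (fun z : vec U (I + J) => F (fstv z) (sndv z)) ->
  approx setT (fun y => kint mu (fun x => F x y)).
Proof. by move=> /(approx_kint muK mud). Qed.

Section Product.
Variables (J : finType) (nu : set (vec U J) -> R).
Hypothesis nuK : is_keisler nu.

Let prod_pf := iterate_pf muK mud (kint_pf nuK).

Lemma morley_indic D : definable setT D ->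
  morley kappa mu nu D = kint nu (fun y => kint mu (fun x => \1_D (pairv x y))).
Proof.
move=> dD; rewrite (morleyE kappa_inf Usat muK mud sA0 iA0) //.
by congr kint; apply/funext => y; rewrite kint_fiber.
Qed.

Lemma morley_keisler : is_keisler (morley kappa mu nu).
Proof.
have [h1 h2 h3] := pf_keisler prod_pf; split.
- by move=> D dD; rewrite morley_indic // h1.
- by rewrite morley_indic // ?h2 //; apply: definableT.
- by move=> D E dD dE DE; rewrite !morley_indic ?h3 //; apply: definableU.
Qed.

Lemma kint_morley h : approx setT h ->
  kint (morley kappa mu nu) h = kint nu (fun y => kint mu (fun x => h (pairv x y))).
Proof.
apply: (pf_ext (kint_pf morley_keisler) prod_pf) => D dD.
by rewrite (kint_indic morley_keisler) // morley_indic.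
Qed.

Lemma morley_definable : definable_measure nu -> definable_measure (morley kappa mu nu).
Proof.
move=> nud K D dD.
pose r (k : I + J + K) : I + (J + K) := match k with
  | inl (inl i) => inl i | inl (inr j) => inr (inl j) | inr k => inr (inr k) end.
have := approx_kint nuK nud (mud (definable_reindex r dD)).
congr approx; apply/funext => b.
rewrite morley_indic; last exact: definable_fiber.
congr kint; apply/funext => y; rewrite (kint_fiber muK); last exact: definable_fiber.
congr mu; apply/seteqP; split=> x; rewrite /fiber /=; congr (D _);
  by apply/funext => -[[]|].
Qed.

End Product.

Lemma mpow_keisler n : is_keisler (mpow kappa mu n).
Proof. by elim: n => //= n IH; apply: morley_keisler. Qed.

Lemma mpow_definable n : definable_measure (mpow kappa mu n).
Proof.
by elim: n => //= n IH; apply: morley_definable => //; apply: mpow_keisler.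
Qed.

Lemma kint_mpowS n h : approx setT h ->
  kint (mpow kappa mu n.+1) h =
  kint (mpow kappa mu n) (fun a => kint mu (fun x => h (pairv x a))).
Proof. by apply: kint_morley; apply: mpow_keisler. Qed.

End MorleyMeasures.

(** * Sampling, definability and symmetry of fim measures *)

Section Fim.
Variables (kappa : Type) (R : realType) (L : language) (U : structure L).
Variables (I : finType) (mu : set (vec U I) -> R) (M : set U).
Hypotheses (muK : is_keisler mu) (mu_fim : fim_over kappa M mu).

Lemma Av01 (J : Type) (s : seq (vec U J)) D : 0 <= @Av R L U J s D <= 1.
Proof.
by apply: avg01 => a; rewrite indicE; case: (_ \in _); rewrite ?lexx ?ler01.
Qed.

(** The supremum in fim becomes a bound for every [b], hence also for a [b] computed from the
    sample. *)
Definition sampling (J : finType) (D : set (vec U (I + J)))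
    (theta : forall n, set (vec U (pidx I n))) :=
  mpow kappa mu n (theta n) @[n --> \oo] --> (1 : R) /\
  forall e, 0 < e -> exists N, forall k, (N <= k)%N -> forall a, theta k a ->
    forall b, `|Av (blocks k a) (fiber D b) - mu (fiber D b)| <= e.

Lemma fim_sampling0 (J : finType) (D : set (vec U (I + J))) : definable set0 D ->
  exists2 theta, forall n, definable M (theta n) & sampling D theta.
Proof.
case: mu_fim => _ _ H dD; have [theta [dth cth Hth]] := H J D dD.
exists theta => //; split=> // e e0; have [N HN] := Hth e e0.
exists N => k Nk a ath b; apply: le_trans (ltW (HN k Nk a ath)).
apply: ub_le_sup; last by exists b.
exists 1 => _ [b' _ <-]; have := Av01 (blocks k a) (fiber D b').
have dDb : definable setT (fiber D b').
  by apply: definable_fiber => //; apply: definable_mono dD.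
have := keisler_le1 muK dDb; have : 0 <= mu (fiber D b') by case: muK => + _ _; apply.
by rewrite ler_norml; lra.
Qed.

(** The parameters of [D] become additional coordinates of [y], in which sampling is uniform. *)
Lemma fim_sampling (J : finType) (D : set (vec U (I + J))) : definable setT D ->
  exists2 theta, forall n, definable M (theta n) & sampling D theta.
Proof.
move=> /definable_set0_fiber [K [E [c [dE _ ->]]]].
pose r (k : I + J + K) : I + (J + K) := match k with
  | inl (inl i) => inl i | inl (inr j) => inr (inl j) | inr k => inr (inr k) end.
have [theta dth [cth Hth]] := fim_sampling0 (definable_reindex r dE).
exists theta => //; split=> // e /Hth [N HN]; exists N => k Nk a ath b.
rewrite (_ : fiber _ b = fiber [set z : vec U (I + (J + K)) | E (z \o r)] (pairv b c)).
  exact: HN.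
by apply/seteqP; split=> x; rewrite /fiber /=; congr (E _);
  apply/funext => -[[]|].
Qed.

(** Read off the definition of the Morley product, because [mpow_keisler] would be circular here: it
    rests on definability of [mu], which is derived from the existence of good samples, and that
    existence uses this value. *)
Lemma morley_set0 (J : finType) (nu : set (vec U J) -> R) :
  morley kappa mu nu set0 = 0.
Proof.
rewrite /morley; case: xgetP => [r _ [A [_ _ _ [P _ ->]]]|//].
rewrite (_ : Fmap mu set0 = cst 0) ?Rintegral_cst ?mul0r //.
by apply/funext => q; rewrite /Fmap /fiber /= (keisler0 muK).
Qed.

Lemma sampling_large (J : finType) (D : set (vec U (I + J))) theta : sampling D theta ->
  forall e, 0 < e -> exists N, forall k, (N <= k)%N -> 1 - e <= mpow kappa mu k (theta k).
Proof.
move=> [cth _] e e0; have /cvgrPdist_le /(_ e e0) [N _ HN] := cth.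
by exists N => k /HN /=; rewrite ler_norml; lra.
Qed.

Lemma sampling_nonempty (J : finType) (D : set (vec U (I + J))) theta :
  sampling D theta -> exists N, forall k, (N <= k)%N -> theta k !=set0.
Proof.
move=> /sampling_large /(_ 2^-1) []; first by rewrite invr_gt0.
move=> N HN; exists N => k /HN; have [->|/set0P //] := eqVneq (theta k) set0.
have -> : mpow kappa mu k set0 = 0.
  by case: k => [|k] /=; [apply: keisler0|apply: morley_set0].
lra.
Qed.

Lemma fim_average (J : finType) (D : set (vec U (I + J))) e : definable setT D -> 0 < e ->
  exists s, forall b, `|Av s (fiber D b) - mu (fiber D b)| <= e.
Proof.
move=> /fim_sampling [theta _ th] e0; have [N1 H1] := sampling_nonempty th.
have [_ /(_ e e0) [N2 H2]] := th.
have [a tha] := H1 (maxn N1 N2) (leq_maxl _ _).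
by exists (blocks _ a); apply: H2 tha; apply: leq_maxr.
Qed.

Lemma fim_definable : definable_measure mu.
Proof.
move=> J D dD; apply: approx_lim => e e0; have [s Hs] := fim_average dD e0.
exists (fun b => Av s (fiber D b)) => [|b]; last by rewrite distrC.
rewrite (_ : (fun b => _) = fun b => (size s)%:R^-1 * \sum_(a <- s) \1_D (pairv a b)).
  apply/approxZ/approx_sum => a; apply/(approx_comp (f := pairv a))/approx_indic => //.
  apply: (definable_fun_pair (f := fun=> a) (g := id)).
    exact: definable_fun_cst.
  exact: definable_fun_id.
by apply/funext => b; rewrite /Av mulrC.
Qed.

Lemma approx_section (J : finType) (h : vec U (I + J) -> R) a :
  approx setT h -> approx setT (fun y => h (pairv a y)).
Proof.
apply/approx_comp/(definable_fun_pair (f := fun=> a) (g := id)).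
  exact: definable_fun_cst.
exact: definable_fun_id.
Qed.

(* Both iterated integrals of an indicator are uniformly approximated by the
   same double average. *)
Lemma fim_fubini (h : vec U (I + I) -> R) : approx setT h ->
  kint mu (fun y => kint mu (fun x => h (pairv x y))) =
  kint mu (fun x => kint mu (fun y => h (pairv x y))).
Proof.
have mud := fim_definable; have mup := kint_pf muK.
pose sw (z : vec U (I + I)) : vec U (I + I) := pairv (sndv z) (fstv z).
have dsw : definable_fun setT sw.
  exact/definable_fun_pair/definable_fun_fst/definable_fun_snd.
have p2 := iterate_pf muK mud mup.
apply: (pf_ext p2 (pf_comp p2 dsw)) => D dD.
change (kint mu (fun y => kint mu (fun x => \1_D (pairv x y))) =
        kint mu (fun x => kint mu (fun y => \1_D (pairv x y)))).
have dDs : definable setT (sw @^-1` D) by apply: definable_preim.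
apply: eq_small => e e0; have e4 : 0 < e / 4 by rewrite divr_gt0.
have [s Hs] := fim_average dD e4; have [t Ht] := fim_average dDs e4.
have aD : approx setT (\1_D : vec U (I + I) -> R) by apply: approx_indic.
have {}Hs y : `|avg s (fun x => \1_D (pairv x y)) - kint mu (fun x => \1_D (pairv x y))| <= e / 4.
  by rewrite kint_fiber //; apply: Hs.
have {}Ht x : `|avg t (fun y => \1_D (pairv x y)) - kint mu (fun y => \1_D (pairv x y))| <= e / 4.
  by have := Ht x; rewrite -(kint_fiber muK x dDs).
have avg_kint (r : seq (vec U I)) (F : vec U I -> vec U I -> R) :
    (forall x, approx setT (F x)) ->
    approx setT (fun y => avg r (F^~ y)) /\
    kint mu (fun y => avg r (F^~ y)) = avg r (fun x => kint mu (F x)).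
  move=> aF; have -> : (fun y => avg r (F^~ y)) = fun y => (size r)%:R^-1 * \sum_(x <- r) F x y.
    by apply/funext => y; rewrite /avg mulrC.
  split; first exact/approxZ/approx_sum.
  by rewrite (pfZ mup) ?(pf_sum mup) 1?mulrC //; apply: approx_sum.
have [a1 k1] := avg_kint s (fun x y => \1_D (pairv x y)) (fun x => approx_section x aD).
have [a2 k2] := avg_kint t (fun y x => \1_D (pairv x y)) (fun y => approx_fiber y aD).
have c1 : `|kint mu (fun y => avg s (fun x => \1_D (pairv x y))) -
            kint mu (fun y => kint mu (fun x => \1_D (pairv x y)))| <= e / 4.
  by apply: (pf_close mup) => //; apply: approx_kint.
have c2 : `|kint mu (fun x => avg t (fun y => \1_D (pairv x y))) -
            kint mu (fun x => kint mu (fun y => \1_D (pairv x y)))| <= e / 4.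
  by apply: (pf_close mup) => //; apply: (approx_kint muK mud (h := fun z => \1_D (sw z))); apply: approx_comp.
have e4' := ltW e4.
have c3 := avg_close s e4' Ht.
have c4 := avg_close t e4' Hs.
have c5 := exchange_avg s t (fun x y => \1_D (pairv x y) : R).
rewrite k1 in c1; rewrite k2 in c2; move: c1 c2 c3 c4.
rewrite c5 !ler_norml; lra.
Qed.

End Fim.

(** * Idempotent fim measures on groups *)

Section SupportTypes.
Variables (R : realType) (L : language) (U : structure L) (I : Type).
Variables (mu : set (vec U I) -> R) (muK : is_keisler mu).

Lemma supp_full (p : types [set: U] I) D :
  supp mu p -> definable setT D -> mu D = 1 -> p D.
Proof.
move=> sp dD D1; have [_ _ /(_ D dD) [//|/sp]] := typeP p.
by rewrite (keislerC muK dD) D1 subrr ltxx.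
Qed.

(** An ultrafilter containing [W] and all definable sets of measure one induces the type: it cannot
    contain a definable null set, whose complement it contains already. Positivity of [mu W] makes
    the generating filter proper. *)
Lemma supp_exists (W : set (vec U I)) : definable setT W -> 0 < mu W ->
  exists2 p : types [set: U] I, supp mu p & p W.
Proof.
move=> dW W0.
pose F := [set X | exists E, [/\ definable setT E, mu E = 1 & W `&` E `<=` X]].
have FF : ProperFilter F.
  split; last split.
  - move=> [E [dE E1 WE]].
    have : mu W <= mu (~` E).
      apply: (keisler_le muK) => // [|x Wx Ex]; [exact: definableC|exact: (WE x)].
    by rewrite (keislerC muK dE) E1 subrr leNgt W0.
  - by exists setT; split=> //; [exact: definableT|case: muK].
  - move=> X Y [E [dE E1 WE]] [E' [dE' E1' WE']]; exists (E `&` E'); split.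
    + exact: definableI.
    + have := keisler_split muK dE dE'; rewrite E1 => e.
      have dC : definable setT (E `&` ~` E') by apply/definableI/definableC.
      have := keisler_le muK dC (definableC dE') (@subIsetr _ _ _).
      rewrite (keislerC muK dE') E1' subrr => h.
      have : 0 <= mu (E `&` ~` E') by case: muK => + _ _; apply.
      lra.
    + by move=> x [Wx [Ex E'x]]; split; [apply: WE|apply: WE'].
  - by move=> X Y XY [E [dE E1 WE]]; exists E; split=> //; apply: subset_trans WE XY.
have [V [UV FV]] := ultraFilterLemma FF.
have pP : is_complete_type setT [set D | definable (setT : set U) D /\ V D].
  split=> [D []//|S /finite_seqP [s ->] Sp|D dD]; last first.
    have [VD|VD] := in_ultra_setVsetC D UV; [by left|right].
    by split=> //; apply: definableC.
  apply: (@filter_ex _ V); elim: s Sp => [|D s IH] Sp.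
    by rewrite (_ : \bigcap_(D in _) D = setT); [apply: filterT|apply/seteqP; split].
  have VD : V D by case: (Sp D (mem_head _ _)).
  have Vs : V (\bigcap_(D in [set` s]) D).
    by apply: IH => E Es; apply: Sp; rewrite /= inE Es orbT.
  apply: filterS (filterI VD Vs) => x [Dx sx] E /=.
  by rewrite inE => /predU1P [-> //|]; apply: sx.
exists (Types pP) => [D [dD VD]|]; last first.
  split=> //; apply: FV; exists setT; split=> [||x []//]; first exact: definableT.
  by case: muK.
rewrite lt_def; apply/andP; split; last by case: muK => + _ _; apply.
apply/eqP => D0; have : V (D `&` ~` D).
  apply: filterI => //; apply: FV; exists (~` D); split=> //; first exact: definableC.
  by rewrite keislerC // D0 subr0.
by rewrite setICr => /filter_ex [].
Qed.

End SupportTypes.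

Section GroupDefinable.
Variables (L : language) (U : structure L) (I : finType) (G : tdgroup U I).
Variable A : set U.

Lemma definable_fun_fstv (J K : finType) (X : Type) (f : vec U X -> vec U (J + K)) :
  definable_fun A f -> definable_fun A (fun x => fstv (f x)).
Proof. by move=> df; have := definable_fun_comp df (@definable_fun_fst _ _ A J K). Qed.

Lemma definable_fun_sndv (J K : finType) (X : Type) (f : vec U X -> vec U (J + K)) :
  definable_fun A f -> definable_fun A (fun x => sndv (f x)).
Proof. by move=> df; have := definable_fun_comp df (@definable_fun_snd _ _ A J K). Qed.

Lemma definable_fun_gmul (X : Type) (f g : vec U X -> vec U I) :
  definable_fun A f -> definable_fun A g ->
  definable_fun A (fun x => gmul G (f x) (g x)).
Proof.
move=> df dg; have dm := definable_funW (@sub0set _ A) (gmul_def G).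
by have := definable_fun_comp (definable_fun_pair df dg) dm.
Qed.

(* The product x_n (x_(n-1) ( ... x_0)); bracketing matters because [gmul] is
   associative only on [gpt G]. *)
Fixpoint prodv (n : nat) : vec U (pidx I n) -> vec U I :=
  match n with
  | 0 => fun a => a
  | n'.+1 => fun a : vec U (I + pidx I n') => gmul G (fstv a) (@prodv n' (sndv a))
  end.

Fixpoint transv (n : nat) : vec U (pidx I n) -> vec U I -> vec U (pidx I n) :=
  match n with
  | 0 => fun a g => gmul G a g
  | n'.+1 => fun (a : vec U (I + pidx I n')) g =>
      pairv (gmul G (fstv a) g) (@transv n' (sndv a) g)
  end.

Lemma definable_fun_prodv (X : Type) n (f : vec U X -> vec U (pidx I n)) :
  definable_fun A f -> definable_fun A (fun x => prodv (f x)).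
Proof.
elim: n f => //= n IH f df; apply: definable_fun_gmul.
  exact: definable_fun_fstv.
exact/IH/definable_fun_sndv.
Qed.

Lemma definable_fun_transv (X : Type) n (f : vec U X -> vec U (pidx I n)) g :
  definable_fun A f -> definable_fun A g ->
  definable_fun A (fun x => transv (f x) (g x)).
Proof.
elim: n f => /= [|n IH] f df dg; first exact: definable_fun_gmul.
apply: definable_fun_pair; first exact/definable_fun_gmul/dg/definable_fun_fstv.
by apply: IH => //; apply: definable_fun_sndv.
Qed.

Lemma blocks_transv n (a : vec U (pidx I n)) g :
  blocks n (transv a g) = [seq gmul G x g | x <- blocks n a].
Proof. by elim: n a => //= n IH a; rewrite IH. Qed.

Lemma size_blocks n (a : vec U (pidx I n)) : size (blocks n a) = n.+1.
Proof. by elim: n a => //= n IH a; rewrite IH. Qed.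

End GroupDefinable.

Ltac dfun :=
  lazymatch goal with
  | |- definable_fun _ (fun z => z) => exact: definable_fun_id
  | |- definable_fun _ (fun z => pairv (@?f z) (@?g z)) =>
      apply: (definable_fun_pair (f := f) (g := g)); dfun
  | |- definable_fun _ (fun z => fstv (@?f z)) =>
      apply: (definable_fun_fstv (f := f)); dfun
  | |- definable_fun _ (fun z => sndv (@?f z)) =>
      apply: (definable_fun_sndv (f := f)); dfun
  | |- definable_fun _ (fun z => gmul _ (@?f z) (@?g z)) =>
      apply: (definable_fun_gmul _ (f := f) (g := g)); dfun
  | |- definable_fun _ (fun z => prodv _ (@?f z)) =>
      apply: (definable_fun_prodv _ (f := f)); dfun
  | |- definable_fun _ (fun z => transv _ (@?f z) (@?g z)) =>
      apply: (definable_fun_transv _ (f := f) (g := g)); dfun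
  | |- definable_fun _ (fun _ => _) => exact: definable_fun_cst
  | _ => idtac
  end.

Section Main.
Variables (kappa : Type) (R : realType) (L : language) (U : structure L).
Hypotheses (kappa_inf : infinite_set [set: kappa]) (Usat : saturated kappa U).
Variables (I : finType) (G : tdgroup U I) (mu : set (vec U I) -> R) (M : set U).
Hypotheses (mu_G : keisler_on G mu) (sM : small kappa M).
Hypotheses (M_elementary : elementary_substructure M).
Hypotheses (mu_fim : fim_over kappa M mu).

Let muK : is_keisler mu. Proof. by case: mu_G. Qed.
Let mud : definable_measure mu. Proof. exact: fim_definable mu_fim. Qed.
Let iM : type_invariant M mu. Proof. by case: mu_fim. Qed.
Let mup := kint_pf muK.
Let nuK n : is_keisler (mpow kappa mu n).
Proof. exact: (mpow_keisler kappa_inf Usat muK mud sM iM). Qed.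
Let nud n : definable_measure (mpow kappa mu n).
Proof. exact: (mpow_definable kappa_inf Usat muK mud sM iM). Qed.
Let nup n := kint_pf (nuK n).

Local Notation "\E[ x ] e" := (kint mu (fun x => e))
  (at level 36, x name, e at level 36, format "\E[ x ]  e").
Local Notation "\E_ n [ a ] e" := (kint (mpow kappa mu n) (fun a => e))
  (at level 36, n at level 0, a name, e at level 36, format "\E_ n [ a ]  e").
Local Notation "x ** y" := (gmul G x y) (at level 35, right associativity).

Let approxE (J : finType) (F : vec U J -> vec U I -> R) :
  approx setT (fun z : vec U (I + J) => F (sndv z) (fstv z)) ->
  approx setT (fun y => \E[x] F y x).
Proof. exact: (approx_kint_curry muK mud (F := fun x y => F y x)). Qed.

Let approxEn n (J : finType) (F : vec U J -> vec U (pidx I n) -> R) :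
  approx setT (fun z : vec U (pidx I n + J) => F (sndv z) (fstv z)) ->
  approx setT (fun y => \E_n[a] F y a).
Proof. exact: (approx_kint_curry (nuK n) (@nud n) (F := fun x y => F y x)). Qed.

Ltac apx :=
  lazymatch goal with
  | |- approx _ (fun y => kint mu (fun x => @?F y x)) =>
      apply: (approxE (F := F)); cbv beta; apx
  | |- approx _ (fun y => kint (mpow kappa mu ?n) (fun x => @?F y x)) =>
      apply: (approxEn (F := F)); cbv beta; apx
  | ah : approx _ ?h |- approx _ (fun z => ?h (@?f z)) =>
      apply: (approx_comp (f := f) _ ah); dfun
  | _ => idtac
  end.

(** Otherwise some type in the support contains [W] together with the partial type of the group, and
    saturation over the finitely many parameters of [W] realizes both. *)
Lemma null_off_group W : definable setT W -> W `&` gpt G = set0 -> mu W = 0.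
Proof.
move=> dW WG; apply/eqP; rewrite eq_le; apply/andP; split; last first.
  by case: muK => + _ _; apply.
rewrite leNgt; apply/negP => /(supp_exists muK dW) [p sp pW].
have [_ Gp] := mu_G; have {}Gp := Gp p sp.
have [J [phi [c [_ eW]]]] := dW.
have s0 : small kappa (set0 `|` range c).
  apply: small_adjoin => //; apply: small_sub sM; exact: sub0set.
have [_ pf _] := typeP p.
have [||x Hx] := Usat s0 (p := gtype G `|` [set W]).
- move=> D [GD|->]; first by apply: definable_mono (gtype_def GD); apply: sub0set.
  by exists J, phi, c; split=> // j; right; exists j.
- by move=> F fF Fp; apply: pf => // D /Fp [/Gp//|->].
have : (W `&` gpt G) x by split=> [|D GD]; apply: Hx; [right|left].
by rewrite WG.
Qed.

Lemma E_ext h h' : approx setT h -> approx setT h' ->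
  (forall x, gpt G x -> h x = h' x) -> \E[x] h x = \E[x] h' x.
Proof.
move=> ah ah' hh'; apply: eq_small => e e0; have e2 : 0 < e / 2 by rewrite divr_gt0.
have [s ds Hs] := approxB ah ah' e2.
(* On the group [h - h'] vanishes, so [s] is at most [e / 2] in absolute value there and [W] misses
   the group. Off [W] the difference of [h] and [h'] is at most [e]. *)
pose W := [set x | e / 2 < seval s x] `|` [set x | e / 2 < seval (sscale (-1) s) x].
have dW : definable setT W.
  by apply: definableU; apply: definable_seval_gt => //; apply: dsimple_scale.
have W0 : mu W = 0.
  apply: null_off_group => //; apply/seteqP; split=> x // [+ /hh' xx].
  have := Hs x; rewrite xx subrr sub0r normrN ler_norml /W /= seval_scale.
  by case=> ?; lra.
(* On [W] the function [`|h - h'|] is only bounded, by some [C]. *)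
have [C HC] : exists C, forall x, `|h x - h' x| <= C.
  have [C HC] : exists C, forall x, `|seval s x| <= C.
    elim: (s) => [|[c D] t [C HC]]; first by exists 0 => x; rewrite /seval big_nil normr0.
    exists (`|c| + C) => x; rewrite /seval big_cons /=.
    apply: (le_trans (ler_normD _ _)); apply: lerD (HC x).
    rewrite normrM ler_piMr // indicE; case: (_ \in _); rewrite ?normr1 ?normr0 //.
  exists (C + e / 2) => x; have := HC x; have := Hs x; rewrite !ler_norml; lra.
have aW : approx setT (\1_W : _ -> R) by apply: approx_indic.
have C0 : 0 <= C by apply: le_trans (HC point).
have bnd x : `|h x - h' x| <= e + C * \1_W x.
  rewrite indicE; have [xW|nxW] := boolP (x \in W).
    by have := HC x; rewrite mulr1; lra.
  have : ~ W x by move=> /mem_set; apply/negP.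
  rewrite /W /= seval_scale => /not_orP [/negP + /negP]; rewrite -!leNgt mulr0 addr0.
  by have := Hs x; rewrite !ler_norml; lra.
have k : \E[x] (e + C * \1_W x) = e.
  rewrite (pfD mup) ?(pfZ mup) ?(kint_indic muK) ?W0 ?(pf_cst mup) ?mulr0 ?addr0 //.
    exact: approx_cst.
  exact: approxZ.
have ak : approx setT (fun x => e + C * \1_W x).
  by apply: approxD; [apply: approx_cst|apply: approxZ].
have l1 : \E[x] (h x - h' x) <= e.
  rewrite -[leRHS]k; apply: (pf_le mup) => //; first exact: approxB.
  by move=> x; have := bnd x; rewrite ler_norml; lra.
have l2 : \E[x] (h' x - h x) <= e.
  rewrite -[leRHS]k; apply: (pf_le mup) => //; first exact: approxB.
  by move=> x; have := bnd x; rewrite ler_norml; lra.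
move: l1 l2; rewrite !(pfB mup) // ler_norml; lra.
Qed.

Let fubini (h : vec U (I + I) -> R) : approx setT h ->
  \E[y] \E[x] h (pairv x y) = \E[x] \E[y] h (pairv x y).
Proof. exact: fim_fubini mu_fim _. Qed.

Let EnS n (h : vec U (pidx I n.+1) -> R) : approx setT h ->
  \E_n.+1[a] h a = \E_n[a] \E[x] h (pairv x a).
Proof. exact: (kint_mpowS kappa_inf Usat muK mud sM iM). Qed.

(** The variable [g] passes the coordinates of the sample one at a time, each by the symmetry of
    [mu] with itself. *)
Lemma fubiniEn n (h : vec U (pidx I n + I) -> R) : approx setT h ->
  \E[g] \E_n[a] h (pairv a g) = \E_n[a] \E[g] h (pairv a g).
Proof.
elim: n h => [|n IH] h ah; first exact: fubini.
rewrite EnS; last apx.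
transitivity (\E[g] \E_n[a] \E[x] h (pairv (pairv x a) g)).
  by congr kint; apply/funext => g; rewrite EnS //; apx.
rewrite (IH (fun z => \E[x] h (pairv (pairv x (fstv z)) (sndv z)))); last apx.
congr kint; apply/funext => a.
by apply: (fubini (h := fun z => h (pairv (pairv (fstv z) a) (sndv z)))); apx.
Qed.

(** * Generic transitivity of idempotent fim measures *)

Section GenericTransitivity.
Hypothesis G_abelian : abelian_group G.
Hypothesis mu_idem : idempotent_measure G kappa mu.

Lemma idemE h : approx setT h -> \E[y] \E[x] h (x ** y) = \E[x] h x.
Proof.
have dm : definable_fun setT (fun z : vec U (I + I) => fstv z ** sndv z) by dfun.
apply: (pf_ext (pf_comp (iterate_pf muK mud mup) dm) mup) => D dD.
rewrite (kint_indic muK dD) -(mu_idem dD) /convolution.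
by rewrite (morley_indic kappa_inf Usat muK mud sM iM muK) //; apply: definable_preim.
Qed.

Lemma prodE n h : approx setT h -> \E_n[a] h (prodv G a) = \E[x] h x.
Proof.
elim: n h => //= n IH h ah; rewrite EnS; last apx.
by rewrite (IH (fun w => \E[x] h (x ** w))) ?idemE //; apx.
Qed.

Lemma approx_blocks (J : finType) n (h : vec U (J + I) -> R) : approx setT h ->
  approx setT (fun z : vec U (J + pidx I n) =>
    \sum_(y <- blocks n (sndv z)) h (pairv (fstv z) y)).
Proof.
move=> ah; elim: n => [|n IH] /=.
  rewrite (_ : (fun z => _) = fun z => h (pairv (fstv z) (sndv z))); first by apx.
  by apply/funext => z; rewrite big_seq1.
rewrite (_ : (fun z => _) = fun z => h (pairv (fstv z) (fstv (sndv z))) +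
    \sum_(y <- blocks n (sndv (sndv z))) h (pairv (fstv z) y)); last first.
  by apply/funext => z; rewrite big_cons.
apply: approxD; first apx.
apply: (approx_comp (f := fun z : vec U (J + (I + pidx I n)) =>
  pairv (fstv z) (sndv (sndv z))) _ IH); dfun.
Qed.

(** For the indicator of phi this counts the indices i with phi(z, x_i), where z is the product of
    the whole sample. *)
Let ev (h : vec U (I + I) -> R) n (a : vec U (pidx I n)) : R :=
  \sum_(y <- blocks n a) h (pairv (prodv G a) y).

Let approx_ev h n : approx setT h -> approx setT (@ev h n).
Proof.
move=> /(approx_blocks n).
apply: (approx_comp (f := fun a => pairv (prodv G a) a)); dfun.
Qed.

(** Treats the leftmost factor of a product: Fubini exchanges the two variables, and commutativity
    moves that factor to the right. *)
Lemma E_gmulC h : approx setT h ->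
  \E[w] \E[x] h (pairv (x ** w) x) = \E[y] \E[x] h (pairv (x ** y) y).
Proof.
move=> ah; rewrite (fubini (h := fun z => h (pairv (fstv z ** sndv z) (fstv z)))); last apx.
apply: E_ext => [||x Gx]; [apx|apx|].
apply: E_ext => [||w Gw]; [apx|apx|].
by rewrite /= G_abelian.
Qed.

(** After rebracketing inside the group, the factors [v] and [x] to the left of [y] merge by
    idempotence. *)
Lemma E_gmulA h : approx setT h ->
  \E[y] \E[x] \E[v] h (pairv (v ** x ** y) y) = \E[y] \E[x] h (pairv (x ** y) y).
Proof.
move=> ah; apply: E_ext => [||y Gy]; [apx|apx|].
rewrite -(idemE (h := fun u => h (pairv (u ** y) y))); last apx.
apply: E_ext => [||x Gx]; [apx|apx|].
apply: E_ext => [||v Gv]; [apx|apx|].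
by rewrite gmulA.
Qed.

(** Integrating out the newest coordinate leaves its own term and a sum of the same shape over the
    shorter sample, for another integrand; the induction in [sum_prodv] therefore ranges over all
    [h]. *)
Lemma E_ev n h a : approx setT h -> \E[x] ev h (n := n.+1) (pairv x a) =
  \E[x] h (pairv (x ** prodv G a) x) +
  ev (fun z => \E[x] h (pairv (x ** fstv z) (sndv z))) a.
Proof.
move=> ah; have -> : ev (fun z => \E[x] h (pairv (x ** fstv z) (sndv z))) a =
    \E[x] (\sum_(y <- blocks n a) h (pairv (x ** prodv G a) y)).
  by rewrite (pf_sum mup) // => y; apx.
rewrite -(pfD mup); first by congr kint; apply/funext => x; rewrite /ev big_cons.
  apx.
by apply: approx_sum => y; apx.
Qed.

(* The summand at the i-th coordinate: by idempotence the factors to the left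
   and to the right of x_i can each be merged into one, and by commutativity
   only one factor is left. *)
Lemma sum_prodv n h : approx setT h ->
  \E_n.+1[a] ev h a = n.+2%:R * \E[y] \E[x] h (pairv (x ** y) y).
Proof.
elim: n h => [|n IH] h ah; (rewrite EnS; last exact: approx_ev).
  transitivity (\E[a] (\E[x] h (pairv (x ** a) x) + \E[x] h (pairv (x ** a) a))).
    by congr kint; apply/funext => a; rewrite E_ev // /ev big_seq1.
  rewrite (pfD mup) ?E_gmulC //; [ring|apx|apx].
pose H z := \E[x] h (pairv (x ** fstv z) (sndv z)).
have aH : approx setT H by rewrite /H; apx.
pose K w := \E[x] h (pairv (x ** w) x).
have aK : approx setT K by rewrite /K; apx.
transitivity (\E_n.+1[a] (K (prodv G a) + ev H a)).
  by congr kint; apply/funext => a; rewrite E_ev.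
rewrite (pfD (nup _)); [|apx|exact: approx_ev].
rewrite prodE // IH // E_gmulC // E_gmulA //; rewrite -[n.+3]addn1 natrD; ring.
Qed.

Lemma generic_transitivity h : approx setT h ->
  \E[y] \E[x] h (pairv (x ** y) y) = \E[y] \E[x] h (pairv x y).
Proof.
have dm : definable_fun setT (fun z : vec U (I + I) => pairv (fstv z ** sndv z) (sndv z)).
  by dfun.
have p2 := iterate_pf muK mud mup.
apply: (pf_ext (pf_comp p2 dm) p2) => D dD.
have aD : approx setT (\1_D : _ -> R) by apply: approx_indic.
change (\E[y] \E[x] (\1_D (pairv (x ** y) y) : R) = \E[y] \E[x] (\1_D (pairv x y) : R)).
(* The sample feeds the second variable of [D] and its product the first. On the right the first
   variable must thus be integrated last, and [sw] puts the sampled variable first, as fim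
   expects. *)
rewrite [RHS]fubini //.
pose sw (z : vec U (I + I)) : vec U (I + I) := pairv (sndv z) (fstv z).
have dsw : definable_fun setT sw by rewrite /sw; dfun.
have dDs : definable setT (sw @^-1` D) by apply: definable_preim.
have [theta dth th] := fim_sampling muK mu_fim dDs.
apply: eq_small => e e0; have e2 : 0 < e / 2 by rewrite divr_gt0.
have [N1 HN1] := sampling_large th e2.
have [_ /(_ _ e2) [N2 HN2]] := th.
pose k := maxn N1 N2.
have N1k : (N1 <= k.+1)%N by rewrite leqW // leq_maxl.
have N2k : (N2 <= k.+1)%N by rewrite leqW // leq_maxr.
have dthk : definable setT (theta k.+1) by apply: definable_mono (dth k.+1).
have ath : approx setT (\1_(theta k.+1) : _ -> R) by apply: approx_indic.
(* The power of index [k.+1] has [k.+2] coordinates. *)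
pose F1 (a : vec U (pidx I k.+1)) := k.+2%:R^-1 * ev \1_D a.
pose m w := \E[y] (\1_D (pairv w y) : R).
pose F2 (a : vec U (pidx I k.+1)) := m (prodv G a).
have am : approx setT m by rewrite /m; apx.
have a1 : approx setT F1 by apply/approxZ/approx_ev.
have a2 : approx setT F2 by rewrite /F2; apx.
have e1 : \E_k.+1[a] F1 a = \E[y] \E[x] (\1_D (pairv (x ** y) y) : R).
  rewrite (pfZ (nup _)); last exact: approx_ev.
  by rewrite sum_prodv // mulKf // pnatr_eq0.
have e3 : \E_k.+1[a] F2 a = \E[x] \E[y] (\1_D (pairv x y) : R) by rewrite prodE.
have mE w : m w = mu (fiber (sw @^-1` D) w).
  by rewrite -(kint_fiber muK w dDs).
have F1E a : F1 a = Av (blocks k.+1 a) (fiber (sw @^-1` D) (prodv G a)).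
  by rewrite /F1 /Av size_blocks mulrC.
have F101 a : 0 <= F1 a <= 1 by rewrite F1E Av01.
have F201 a : 0 <= F2 a <= 1.
  have d : definable setT (fiber (sw @^-1` D) (prodv G a)) by apply: definable_fiber.
  by rewrite /F2 mE (keisler_le1 muK d) andbT; case: muK => + _ _; apply.
(* Outside the good set both values lie in [0, 1], so the error there is at most 1 and integrates to
   the measure of the complement. *)
have close a : `|F1 a - F2 a| <= e / 2 + (1 - \1_(theta k.+1) a).
  rewrite indicE; have [ta|nta] := boolP (a \in theta k.+1).
    by rewrite subrr addr0 F1E /F2 mE; apply: HN2 => //; apply: set_mem.
  have := F101 a; have := F201 a; rewrite subr0 ler_norml; lra.
pose B (a : vec U (pidx I k.+1)) : R := e / 2 + (1 - \1_(theta k.+1) a).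
have aB : approx setT B.
  by apply: approxD; [apply: approx_cst|apply: approxB => //; apply: approx_cst].
have EB : \E_k.+1[a] B a <= e.
  rewrite (pfD (nup _)) ?(pfB (nup _)) ?(pf_cst (nup _)) ?(kint_indic (nuK _)) //;
    try exact: approx_cst.
    have := HN1 _ N1k; lra.
  by apply: approxB => //; apply: approx_cst.
have l1 : \E_k.+1[a] (F1 a - F2 a) <= \E_k.+1[a] B a.
  apply: (pf_le (nup _)) => // [|a]; first exact: approxB.
  by have := close a; rewrite ler_norml /B; lra.
have l2 : \E_k.+1[a] (F2 a - F1 a) <= \E_k.+1[a] B a.
  apply: (pf_le (nup _)) => // [|a]; first exact: approxB.
  by have := close a; rewrite ler_norml /B; lra.
move: l1 l2; rewrite -e1 -e3 !(pfB (nup _)) // ler_norml; lra.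
Qed.

(* The coordinates are translated one at a time: Fubini brings [g] next to the
   coordinate [x] in question, and generic transitivity applies. *)
Lemma E_transv n (h : vec U (pidx I n + I) -> R) : approx setT h ->
  \E[g] \E_n[a] h (pairv (transv G a g) g) = \E[g] \E_n[a] h (pairv a g).
Proof.
elim: n h => [|n IH] h ah; first exact: generic_transitivity.
transitivity (\E[g] \E_n[a] \E[x] h (pairv (pairv (x ** g) (transv G a g)) g)).
  by congr kint; apply/funext => g; rewrite EnS //; apx.
transitivity (\E[g] \E_n[a] \E[x] h (pairv (pairv x (transv G a g)) g)).
  rewrite (fubiniEn (h := fun z => \E[x] h (pairv (pairv (x ** sndv z)
    (transv G (fstv z) (sndv z))) (sndv z)))); last apx.
  rewrite (fubiniEn (h := fun z => \E[x] h (pairv (pairv x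
    (transv G (fstv z) (sndv z))) (sndv z)))); last apx.
  congr kint; apply/funext => a.
  apply: (generic_transitivity (h := fun z => h (pairv (pairv (fstv z)
    (transv G a (sndv z))) (sndv z)))).
  apx.
rewrite (IH (fun z => \E[x] h (pairv (pairv x (fstv z)) (sndv z)))); last apx.
by congr kint; apply/funext => g; rewrite EnS //; apx.
Qed.

Lemma generically_transitiveP : generically_transitive G kappa mu.
Proof.
move=> D dD; pose f (z : vec U (I + I)) : vec U (I + I) := pairv (fstv z ** sndv z) (sndv z).
have df : definable_fun setT f by rewrite /f; dfun.
have dfD : definable setT (f @^-1` D) by apply: definable_preim.
rewrite /pushfwd /= !(morley_indic kappa_inf Usat muK mud sM iM muK) //.
by rewrite -generic_transitivity //; apply: approx_indic.
Qed.

(** * Types in the support and the stabilizer *)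

Lemma average_simple n (a : vec U (pidx I n)) (J : finType) (E : set (vec U (I + J))) :
  (forall i, M (a i)) -> definable M E ->
  exists2 t : simple R U J, dsimple M t &
    forall y, seval t y = Av (blocks n a) (fiber E y).
Proof.
move=> Ma dE.
have [t dt Ht] : exists2 t : simple R U J, dsimple M t &
    forall y, seval t y = \sum_(x <- blocks n a) \1_(fiber E y) x.
  have sec (x : vec U I) : (forall i, M (x i)) -> definable M [set y | E (pairv x y)].
    by move=> Mx; apply: definable_param.
  elim: n a Ma => [|n IH] a Ma /=.
    exists [:: (1, [set y | E (pairv a y)])] => [|y]; first by split=> //; apply: sec.
    by rewrite /seval !big_seq1 mul1r.
  have [t dt Ht] := IH (sndv a) (fun i => Ma (inr i)).
  exists ((1, [set y | E (pairv (fstv a) y)]) :: t) => [|y].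
    by split=> //; apply: sec => i; apply: (Ma (inl i)).
  by rewrite /seval !big_cons mul1r -Ht.
exists (sscale (size (blocks n a))%:R^-1 t) => [|y]; first exact: dsimple_scale.
by rewrite seval_scale Ht /Av mulrC.
Qed.

Lemma stab_approx (J : finType) (E : set (vec U (I + J))) e : definable set0 E -> 0 < e ->
  exists Y, [/\ definable M Y, stab G mu `<=` Y, mu Y = 1 & forall g, Y g ->
    forall b, `|mu [set x | E (pairv (x ** g) b)] - mu (fiber E b)| <= e].
Proof.
(* Membership in [Y] allows four errors [d]: two from the averages over points of [M], one from a
   good sample and one from its good translate. Returning from [Y] to the measures costs two
   more. *)
move=> dE e0; pose d := e / 6%:R; have d0 : 0 < d by rewrite divr_gt0.
pose f2 (z : vec U (I + (I + J))) : vec U (I + J) :=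
  pairv (fstv z ** fstv (sndv z)) (sndv (sndv z)).
have df2 : definable_fun set0 f2 by rewrite /f2; dfun.
pose E2 := f2 @^-1` E.
have dE2 : definable set0 E2 by apply: definable_preim.
have [th1 dth1 s1] := fim_sampling0 muK mu_fim dE.
have [th2 dth2 s2] := fim_sampling0 muK mu_fim dE2.
have [N1 H1] := sampling_nonempty muK s1; have [N2 H2] := sampling_nonempty muK s2.
have [_ /(_ d d0) [N3 H3]] := s1; have [_ /(_ d d0) [N4 H4]] := s2.
have [N hN] : exists N, [/\ (N1 <= N)%N, (N2 <= N)%N, (N3 <= N)%N & (N4 <= N)%N].
  by exists (N1 + N2 + N3 + N4)%N; split; lia.
case: hN => hN1 hN2 hN3 hN4.
have [a1 ta1 Ma1] := elementary_substructure_meets M_elementary (dth1 N) (H1 N hN1).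
have [a2 ta2 Ma2] := elementary_substructure_meets M_elementary (dth2 N) (H2 N hN2).
have M0 X (D : set (vec U X)) : definable set0 D -> definable M D.
  by apply: definable_mono; apply: sub0set.
have [t1 dt1 Ht1] := average_simple Ma1 (M0 _ _ dE).
have [t2 dt2 Ht2] := average_simple Ma2 (M0 _ _ dE2).
have c1 b : `|seval t1 b - mu (fiber E b)| <= d by rewrite Ht1 H3.
have c2 g b : `|seval t2 (pairv g b) - mu (fiber E2 (pairv g b))| <= d by rewrite Ht2 H4.
pose Y := [set g | forall b, `|seval t2 (pairv g b) - seval t1 b| <= 4 * d].
have dY : definable M Y.
  pose t := t2 ++ sscale (-1) (scomp (@sndv L U I J) t1).
  have dt : dsimple M t.
    by apply/dsimple_cat/dsimple_scale/dsimple_comp => //; apply: definable_fun_snd.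
  have dt' : dsimple M (sscale (-1) t) by apply: dsimple_scale.
  have := definable_forall (definableI (definableC (definable_seval_gt (4 * d) dt))
    (definableC (definable_seval_gt (4 * d) dt'))).
  apply: definable_ext => g; split=> H b; have := H b;
    rewrite /setI /setC /= ?ler_norml !seval_scale !seval_cat !seval_scale !seval_comp;
    rewrite (_ : sndv (pairv g b) = b) //.
    by move=> [/negP + /negP]; rewrite -!leNgt => ? ?; lra.
  by move=> /andP [? ?]; split; apply/negP; rewrite -leNgt; lra.
exists Y; split=> //.
- move=> g [_ Sg] b; have := c1 b; have := c2 g b.
  have -> : mu (fiber E2 (pairv g b)) = mu (fiber E b).
    by apply: Sg; apply: definable_fiber => //; apply: definable_mono dE.
  by rewrite !ler_norml; lra.
- have dYT : definable setT Y by apply: definable_mono dY.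
  suff : mu (~` Y) = 0 by rewrite (keislerC muK dYT); lra.
  have aY : approx setT (\1_(~` Y) : _ -> R) by apply/approx_indic/definableC.
  have Y0 : 0 <= mu (~` Y) by case: muK => + _ _; apply; apply: definableC.
  apply/eqP; rewrite eq_le Y0 andbT; apply/ler_addgt0Pl => r r0; rewrite addr0.
  have r2 : 0 < r / 2 by rewrite divr_gt0.
  have [N5 H5] := sampling_large s1 r2; have [N6 H6] := sampling_large s2 r2.
  pose k := (N3 + N4 + N5 + N6)%N.
  have k3 : (N3 <= k)%N by rewrite /k; lia.
  have k4 : (N4 <= k)%N by rewrite /k; lia.
  have k5 : (N5 <= k)%N by rewrite /k; lia.
  have k6 : (N6 <= k)%N by rewrite /k; lia.
  have dT1 : definable setT (th1 k) by apply: definable_mono (dth1 k).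
  have dT2 : definable setT (th2 k) by apply: definable_mono (dth2 k).
  have aT1 : approx setT (\1_(th1 k) : _ -> R) by apply: approx_indic.
  have aT2 : approx setT (\1_(th2 k) : _ -> R) by apply: approx_indic.
  (* If [a] is good for [E2] and its translate by [g] is good for [E], the two averages coincide and
     [g] lies in [Y]; hence the three indicators are never all 1. *)
  have bnd g a : (\1_(~` Y) g : R) + (\1_(th2 k) a + \1_(th1 k) (transv G a g)) <= 2.
    have i01 (X : Type) (D : set X) x : 0 <= (\1_D x : R) <= 1.
      by rewrite indicE; case: (_ \in _); rewrite ?lexx ?ler01.
    have := i01 _ (~` Y) g; have := i01 _ (th2 k) a.
    have := i01 _ (th1 k) (transv G a g).
    have [tg|ntg] := pselect (th1 k (transv G a g)); last first.
      by rewrite [\1_(th1 k) _]indicE memNset //=; lra.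
    have [ta|nta] := pselect (th2 k a); last first.
      by rewrite [\1_(th2 k) _]indicE memNset //=; lra.
    suff Yg : Y g.
      by rewrite [\1_(~` Y) _]indicE memNset //=; lra.
    move=> b; have := c1 b; have := c2 g b.
    have := H3 k k3 _ tg b; have := H4 k k4 _ ta (pairv g b).
    rewrite /Av blocks_transv big_map size_map !ler_norml.
    have -> : \sum_(x <- blocks k a) \1_(fiber E b) (x ** g) =
      \sum_(x <- blocks k a) \1_(fiber E2 (pairv g b)) x :> R.
      by [].
    lra.
  pose h1 (z : vec U (pidx I k + I)) : R := \1_(th1 k) (fstv z).
  have ah1 : approx setT h1 by rewrite /h1; apx.
  have S1 : \E[g] \E_k[a] (\1_(th1 k) (transv G a g) : R) = mpow kappa mu k (th1 k).
    rewrite (E_transv (h := h1)) // (_ : (fun g => _) = fun=> mpow kappa mu k (th1 k)).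
      by rewrite (pf_cst mup).
    by apply/funext => g; rewrite -(kint_indic (nuK k)).
  (* Each good set has measure at least [1 - r / 2], the translated one by [E_transv], which leaves
     at most [r] for the complement of [Y]. *)
  have := H5 k k5; have := H6 k k6; rewrite -S1 -(kint_indic (nuK k) dT2).
  rewrite -(kint_indic muK (definableC dYT)).
  suff : \E[g] (\1_(~` Y) g : R) + (\E_k[a] (\1_(th2 k) a : R) +
     \E[g] \E_k[a] (\1_(th1 k) (transv G a g) : R)) <= 2 by lra.
  have aTr : approx setT (fun g => \E_k[a] (\1_(th1 k) (transv G a g) : R)) by apx.
  rewrite -[X in _ + (X + _)](pf_cst mup) -(pfD mup) //; last exact: approx_cst.
  rewrite -(pfD mup) //; last by apply: approxD => //; apply: approx_cst.
  rewrite -[leRHS](pf_cst mup); apply: (pf_le mup) => [||g].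
  + by apply: approxD => //; apply: approxD => //; apply: approx_cst.
  + exact: approx_cst.
  have aTg : approx setT (fun a => \1_(th1 k) (transv G a g) : R) by apx.
  rewrite -[X in X + _](pf_cst (nup k)) -(pfD (nup k)) // -(pfD (nup k)) //; last 2 first.
  + exact: approx_cst.
  + exact: approxD.
  rewrite -[leRHS](pf_cst (nup k)); apply: (pf_le (nup k)) => //.
  + by apply: approxD; [apply: approx_cst|apply: approxD].
  + exact: approx_cst.
- move=> g Yg b; have := Yg b; have := c1 b; have := c2 g b.
  rewrite (_ : fiber E2 (pairv g b) = [set x | E (pairv (x ** g) b)]) //.
  by rewrite !ler_norml /d; lra.
Qed.

(** A type in the support contains all definable sets of measure one, so those over [M] that contain
    the stabilizer form a suitable partial type. They cut out exactly the stabilizer: the formulas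
    of the group are among them by [null_off_group], and [stab_approx] for all [e] gives
    invariance. *)
Lemma supp_stab p : supp mu p -> implies_set kappa p (stab G mu).
Proof.
move=> sp; exists M, [set Y | [/\ definable M Y, stab G mu `<=` Y & mu Y = 1]].
split=> // [Y [] //||Y [dY _ Y1]]; last first.
  by apply: (supp_full muK) => //; apply: definable_mono dY.
apply/seteqP; split=> [g Hg|g Sg Y [_ SY _]]; last exact: SY.
split.
  move=> D GD; apply: Hg.
  have dD : definable setT D by apply: definable_mono (gtype_def GD).
  split; first by apply: definable_mono (gtype_def GD); apply: sub0set.
    by move=> h [Gh _]; apply: Gh.
  have : mu (~` D) = 0.
    apply: null_off_group; first exact: definableC.
    by apply/seteqP; split=> x // [nD Gx]; apply: nD; apply: Gx.
  by rewrite (keislerC muK dD); lra.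
move=> D /definable_set0_fiber [J [E [c [dE _ ->]]]].
apply: eq_small => e /(stab_approx dE) [Y [dY SY Y1 HY]].
by apply: (HY g); apply: Hg.
Qed.

End GenericTransitivity.

End Main.

(** Every language has infinitely many formulas, the equations x_n = x_n, and a finite [kappa] would
    inject into them. *)
Lemma infinite_cardinal (kappa : Type) (L : language) :
  small kappa [set: form L nat] -> infinite_set [set: kappa].
Proof.
move=> sf /finite_set_countable kN; apply: sf; apply: card_le_trans kN _.
pose f n : form L nat := Eq (@Var L _ n) (@Var L _ n).
have fi : {in [set: nat] &, injective f} by move=> m n _ _ [].
have /card_eqPle [_ fN] := inj_card_eq fi.
exact: card_le_trans fN (card_leT _).
Qed.

Theorem theorem3p33 (R : realType) (L : language) (T : theory L)
    (kappa : Type) (U : structure L) (I : finType) (G : tdgroup U I)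
    (mu : set (vec U I) -> R)
    (T_complete : complete_theory T)
    (U_monster : monster_model kappa T U)
    (G_abelian : abelian_group G)
    (mu_G : keisler_on G mu)
    (mu_fim : fim kappa mu)
    (mu_idem : idempotent_measure G kappa mu) :
  generically_transitive G kappa mu /\
  (forall p : types (@setT U) I, supp mu p -> implies_set kappa p (stab G mu)).
Proof.
case: U_monster => _ /infinite_cardinal kappa_inf _ Usat _.
case: mu_fim => M [sM M_elem mu_fim].
split; first exact: (generically_transitiveP kappa_inf Usat mu_G sM mu_fim).
move=> p; exact: (supp_stab kappa_inf Usat mu_G sM M_elem mu_fim).
Qed.
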